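(* For every integer $d\ge 1$, the class of (finite) graphs of sphere dimension at most $d$ has asymptotic dimension at most $2d+2$.
   Context: For $d\ge 2$, a sphere in $\mathbb{R}^d$ is the boundary of a closed Euclidean ball of positive radius, and $\mathcal{S}^{d}$ is the class of intersection graphs of finite families of spheres in $\mathbb{R}^d$; $\mathcal{S}^1$ is the class of circle graphs (intersection graphs of finite families of chords of a circle). The sphere dimension of a graph $G$ is the least $d\ge1$ with $G\in\mathcal{S}^d$. For a graph $G$ with its shortest-path metric $\mathrm{dist}$ (distance $\infty$ between different components), a family $\mathcal U$ of vertex subsets is $D$-bounded if every member has diameter at most $D$, and $r$-disjoint if any two vertices in different members of $\mathcal U$ are at distance greater than $r$. A function $D:\mathbb{R}_+\to\mathbb{R}_+$ is an $n$-dimensional control function for a class $\mathcal C$ if for every $G\in\mathcal C$ and every $r>0$, $V(G)$ has a cover $\mathcal U=\bigcup_{i=1}^{n+1}\mathcal U_i$ where each $\mathcal U_i$ is $r$-disjoint and every member of $\mathcal U$ is $D(r)$-bounded. The asymptotic dimension of $\mathcal C$ is the least $n$ for which an $n$-dimensional control function exists. *)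

(* Defs.v *)
From HB Require Import structures.
From mathcomp Require Import all_boot all_order all_algebra.
From mathcomp Require Import Rstruct.
Set Implicit Arguments. Unset Strict Implicit. Unset Printing Implicit Defensive.
Import Order.TTheory GRing.Theory Num.Theory.
Local Open Scope ring_scope.

Notation R := Rdefinitions.R.

Definition sqdist (d : nat) (x y : 'I_d -> R) : R := \sum_(i < d) (x i - y i) ^+ 2.

Definition on_sphere (d : nat) (c : 'I_d -> R) (r : R) (x : 'I_d -> R) : Prop :=
  sqdist x c = r ^+ 2.

Definition spheres_meet (d : nat) (c1 : 'I_d -> R) (r1 : R) (c2 : 'I_d -> R) (r2 : R) : Prop :=
  exists x : 'I_d -> R, on_sphere c1 r1 x /\ on_sphere c2 r2 x.

(* S^d membership (d >= 2 intended): (V,e) is the intersection graph of a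
   finite family of spheres of positive radius indexed by V *)
Definition sphere_graph (d : nat) (V : finType) (e : rel V) : Prop :=
  exists (c : V -> 'I_d -> R) (rad : V -> R),
    (forall v, 0 < rad v) /\
    (forall u v, u != v -> (e u v <-> spheres_meet (c u) (rad u) (c v) (rad v))).

Definition on_circle (p : R * R) : Prop := p.1 ^+ 2 + p.2 ^+ 2 = 1.

Definition on_chord (p q x : R * R) : Prop :=
  exists t : R, 0 <= t /\ t <= 1 /\
    x = ((1 - t) * p.1 + t * q.1, (1 - t) * p.2 + t * q.2).

Definition circle_graph (V : finType) (e : rel V) : Prop :=
  exists P Q : V -> R * R,
    (forall v, on_circle (P v) /\ on_circle (Q v) /\ P v <> Q v) /\
    (forall u v, u != v ->
       (e u v <-> exists x, on_chord (P u) (Q u) x /\ on_chord (P v) (Q v) x)).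

Definition in_S (d : nat) (V : finType) (e : rel V) : Prop :=
  if d == 1%N then circle_graph e else sphere_graph d e.

Definition simple_graph (V : finType) (e : rel V) : Prop :=
  symmetric e /\ irreflexive e.

Definition sphere_dim_le (d : nat) (V : finType) (e : rel V) : Prop :=
  simple_graph e /\ exists d' : nat, (1 <= d')%N /\ (d' <= d)%N /\ in_S d' e.

(* dist(u,v) <= x in the shortest-path metric (false if disconnected) *)
Definition dist_le (V : finType) (e : rel V) (u v : V) (x : R) : Prop :=
  exists p : seq V, path e u p /\ last u p = v /\ (size p)%:R <= x.

Definition bounded_set (V : finType) (e : rel V) (D : R) (U : {set V}) : Prop :=
  forall u v, u \in U -> v \in U -> dist_le e u v D.

Definition r_disjoint (V : finType) (e : rel V) (r : R) (F : {set {set V}}) : Prop :=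
  forall U U', U \in F -> U' \in F -> U != U' ->
    forall u v, u \in U -> v \in U' -> ~ dist_le e u v r.

Definition graph_class := forall V : finType, rel V -> Prop.

Definition control_function (n : nat) (D : R -> R) (C : graph_class) : Prop :=
  (forall r, 0 < r -> 0 <= D r) /\
  forall (V : finType) (e : rel V), C V e ->
  forall r : R, 0 < r ->
  exists Us : 'I_n.+1 -> {set {set V}},
    (forall v : V, exists i U, U \in Us i /\ v \in U) /\
    (forall i, r_disjoint e r (Us i)) /\
    (forall i U, U \in Us i -> bounded_set e (D r) U).

Definition asdim_le (C : graph_class) (n : nat) : Prop :=
  exists m : nat, (m <= n)%N /\ exists D : R -> R, control_function m D C.

(* Main.v *)
Require Import Defs.
From mathcomp Require Import all_boot all_order all_algebra.
From mathcomp Require boolp.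
From mathcomp Require Import Rstruct zify ring lra.
Set Implicit Arguments. Unset Strict Implicit. Unset Printing Implicit Defensive.

(** A sphere family is recorded by centres and radii, two spheres meeting iff
    [|r - r'| <= |c - c'| <= r + r']; stereographic projection turns chords of a circle
    into intervals, giving the same criterion with [d = 1].

    In each component take the largest sphere as root and let [L] be the distance to it.
    If one of two spheres lies strictly inside the other, a geodesic from it to the root
    has to cross the outer sphere; so within a bounded range of levels of [L], spheres
    whose balls intersect are close in the graph, and the graph may be replaced there by
    the intersection graph of balls.

    A ball graph gets [2 (d + 1)] colours. Cover space at each scale by [d + 1] families of
    well-separated bounded cells, and class a ball by a cell containing the largest ball
    near it. Inside one class, a chain of short steps through balls of bounded scale stays
    in a region of that scale, which meets boundedly many disjoint larger balls. Hence the
    class has an elimination order (by radius) whose bags are covered by boundedly many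
    cliques, like a tree-decomposition of bounded width, and such graphs have asymptotic
    dimension at most 1.

    Finally the blocks of levels are glued at the cost of one more colour, for a total of
    [2 d + 3]: blocks are coloured alternately at a fine and at a much coarser scale, so
    that fine pieces attach to at most one coarse piece at either end, and inside each fine
    block every colour class is cut by the extra colour, at a level of its own. *)

(** * Graph distance and chains *)

Ltac ar := repeat match goal with
  | x := _ : nat |- _ => clearbody x
  | H : ?T |- _ => lazymatch T with nat => fail | is_true (leq _ _) => fail | @eq nat _ _ => fail | _ => clear H end
  end; lia.

Lemma connect_inv (T : finType) (R : rel T) (I : T -> Prop) :
  (forall a b, I a -> R a b -> I b) -> forall u v, I u -> connect R u v -> I v.
Proof.
move=> step u v Iu /connectP[p]; elim: p u Iu => [|x p IH] u Iu /=; first by move=> _ ->.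
by move=> /andP[ux px] vE; apply: (IH x) => //; apply: step ux.
Qed.

Lemma split_last (T : eqType) (P : pred T) (u : T) (p : seq T) :
  P u -> exists p1 p2, [/\ p = p1 ++ p2, P (last u p1) & all (predC P) p2].
Proof.
move=> Pu; elim/last_ind: p => [|p x [p1 [p2 [-> Pl al]]]]; first by exists [::], [::].
have [Px|nPx] := boolP (P x).
  by exists (rcons (p1 ++ p2) x), [::]; rewrite cats0 last_rcons.
by exists p1, (rcons p2 x); rewrite rcons_cat all_rcons /= nPx.
Qed.

Section GraphDistance.
Variable V : finType.
Implicit Types (e : rel V) (u v w : V) (X Y Z : {set V}).

(** Distance at most [k], as a boolean recursion on the length bound. The real-valued [dist_le] is
    translated into it only at the very end. *)
Fixpoint dle e k u v : bool :=
  (u == v) || (if k is k'.+1 then [exists w, e u w && dle e k' w v] else false).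

Lemma dle0 e u v : dle e 0 u v = (u == v).
Proof. by rewrite /= orbF. Qed.

Lemma dleS e k u v :
  dle e k.+1 u v = (u == v) || [exists w, e u w && dle e k w v].
Proof. by []. Qed.

Arguments dle : simpl never.

Lemma dle_refl e k u : dle e k u u.
Proof. by case: k => [|k]; rewrite ?dle0 ?dleS eqxx. Qed.

Lemma dle_cons e k u w v : e u w -> dle e k w v -> dle e k.+1 u v.
Proof.
by move=> uw wv; rewrite dleS; apply/orP; right; apply/existsP; exists w; rewrite uw.
Qed.

Lemma dle_case e k u v :
  dle e k.+1 u v -> u = v \/ exists2 w, e u w & dle e k w v.
Proof.
rewrite dleS => /orP[/eqP->|/existsP[w /andP[uw wv]]]; first by left.
by right; exists w.
Qed.

Lemma dle_mono e k l u v : k <= l -> dle e k u v -> dle e l u v.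
Proof.
elim: k l u => [|k IH] [|l] u // kl.
  by rewrite dle0 => /eqP->; apply: dle_refl.
case/dle_case=> [->|[w uw wv]]; first exact: dle_refl.
by apply: dle_cons uw _; apply: IH.
Qed.

Lemma dle_trans e k l u v w : dle e k u v -> dle e l v w -> dle e (k + l) u w.
Proof.
elim: k u => [|k IH] u; first by rewrite dle0 => /eqP->.
case/dle_case=> [->|[x ux xv]] vw; first by apply: (@dle_mono e l) => //; lia.
by rewrite addSn; apply: dle_cons ux _; apply: IH.
Qed.

Lemma dle_edge e u v : e u v -> dle e 1 u v.
Proof. by move=> uv; apply: dle_cons uv _; apply: dle_refl. Qed.

Lemma dle_sym e : symmetric e -> forall k u v, dle e k u v -> dle e k v u.
Proof.
move=> se; elim=> [|k IH] u v; first by rewrite !dle0 eq_sym.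
case/dle_case=> [->|[w uw wv]]; first exact: dle_refl.
by rewrite -addn1; apply: dle_trans (IH _ _ wv) _; apply: dle_edge; rewrite se.
Qed.

Lemma dle_symE e : symmetric e -> forall k u v, dle e k u v = dle e k v u.
Proof. by move=> se k u v; apply/idP/idP; apply: dle_sym. Qed.

(** The first edge of a walk that leaves [P], with the lengths on both sides recorded. All separator
    arguments below rest on it. *)
Lemma dle_exit e (P : pred V) k u v : dle e k u v -> P u -> ~~ P v ->
  exists w w' a b, [/\ P w, ~~ P w', e w w', dle e a u w & dle e b w' v /\ a + b.+1 <= k].
Proof.
elim: k u => [|k IH] u; first by rewrite dle0 => /eqP-> ->.
case/dle_case=> [-> -> //|[x ux xv] Pu nPv].
have [Px|nPx] := boolP (P x); last first.
  by exists u, x, 0, k; split=> //; rewrite ?dle_refl.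
have [w [w' [a [b [Pw nPw' ww' xw [w'v ab]]]]]] := IH x xv Px nPv.
by exists w, w', a.+1, b; split=> //; apply: dle_cons xw.
Qed.

Lemma dle_scale e e' m : (forall u v, e u v -> dle e' m u v) ->
  forall k u v, dle e k u v -> dle e' (k * m) u v.
Proof.
move=> ee'; elim=> [|k IH] u v; first by rewrite dle0 => /eqP->; apply: dle_refl.
case/dle_case=> [->|[w uw wv]]; first exact: dle_refl.
by rewrite mulSn; apply: dle_trans (ee' _ _ uw) (IH _ _ wv).
Qed.

Lemma dle_sub e e' : subrel e e' -> forall k u v, dle e k u v -> dle e' k u v.
Proof.
move=> ee' k u v; rewrite -{2}[k]muln1; apply: dle_scale => a b ab.
by apply: dle_edge; apply: ee'.
Qed.

Lemma dle_avoid e (P : pred V) k u v : (forall w, dle e k u w -> P w) ->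
  dle e k u v -> dle [rel a b | [&& e a b, P a & P b]] k u v.
Proof.
elim: k u => [|k IH] u HP; first by rewrite !dle0.
case/dle_case=> [->|[w uw wv]]; first exact: dle_refl.
have st x : dle e k w x -> P x by move=> wx; apply: HP; apply: dle_cons wx.
apply: (@dle_cons _ _ _ w); last exact: IH.
by rewrite /= uw HP ?dle_refl // st // dle_refl.
Qed.

Lemma dle_connect e k u v : dle e k u v -> connect e u v.
Proof.
elim: k u => [|k IH] u; first by rewrite dle0 => /eqP->.
case/dle_case=> [->//|[w uw wv]].
by apply: connect_trans (connect1 uw) (IH _ wv).
Qed.

Lemma dle_path e k u v :
  dle e k u v -> exists p, [/\ path e u p, last u p = v & size p <= k].
Proof.
elim: k u => [|k IH] u; first by rewrite dle0 => /eqP->; exists [::].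
case/dle_case=> [->|[w uw /IH[p [wp <- sp]]]]; first by exists [::].
by exists (w :: p); rewrite /= uw wp.
Qed.

Lemma path_dle e u p : path e u p -> dle e (size p) u (last u p).
Proof.
elim: p u => [|x p IH] u /=; first by rewrite dle_refl.
by case/andP=> ux xp; apply: dle_cons ux (IH _ xp).
Qed.

Definition near e k (Y : {set V}) u := [exists y in Y, dle e k u y].

Lemma nearP e k Y u : reflect (exists2 y, y \in Y & dle e k u y) (near e k Y u).
Proof. exact: exists_inP. Qed.

Lemma near_mono e k l Y Z u :
  k <= l -> Y \subset Z -> near e k Y u -> near e l Z u.
Proof.
move=> kl /subsetP YZ /nearP[y yY uy]; apply/nearP; exists y; first exact: YZ.
exact: dle_mono uy.
Qed.

Lemma near_step e k l Y u v : dle e l v u -> near e k Y u -> near e (l + k) Y v.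
Proof.
by move=> vu /nearP[y yY uy]; apply/nearP; exists y => //; apply: dle_trans uy.
Qed.

Definition clique e (Q : {set V}) := forall u v, u \in Q -> v \in Q -> dle e 1 u v.

Definition covered e N (Y : {set V}) := exists L : seq {set V},
  [/\ size L <= N, forall Q, Q \in L -> clique e Q &
      forall y, y \in Y -> exists2 Q, Q \in L & y \in Q].

(** Let [Q] be a clique near [u] and jump to the last vertex of the path near [Q]. The jump costs
    [2 * M + 1] and the next step [r]; the rest of the path never comes near [Q] again, so [Q] is
    dropped and the argument repeats. *)
Lemma clique_chain e r M (L : seq {set V}) : symmetric e ->
  (forall Q, Q \in L -> clique e Q) ->
  forall u p, path (dle e r) u p ->
    (forall w, w \in u :: p -> exists2 Q, Q \in L & near e M Q w) ->
    dle e (size L * (2 * M + 1 + r)) u (last u p).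
Proof.
move=> se; elim: {L}(size L) {-2}L (erefl (size L)) => [|n IH] L sL cL u p up nL.
  by have [|Q] := nL u; rewrite ?mem_head //; move/size0nil: sL => ->.
have [|Q QL nQu] := nL u; first exact: mem_head.
have nearQ w : near e M Q w -> dle e (2 * M + 1) u w.
  move=> /nearP[y yQ wy]; case/nearP: nQu => x xQ ux.
  apply: (@dle_mono e (M + 1 + M)); first lia.
  by apply: dle_trans (dle_sym se wy); apply: dle_trans ux (cL Q QL _ _ xQ yQ).
have [p1 [p2 [pE lQ al]]] := split_last p nQu.
move: up nL; rewrite {}pE cat_path last_cat => /andP[up1 p2p] nL.
case: p2 => [|x p2] /= in p2p al nL *.
  by apply: dle_mono (nearQ _ lQ); rewrite sL; lia.
case/andP: p2p => lx xp2; case/andP: al => nx al.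
rewrite sL mulSn; apply: (@dle_trans e _ _ _ x).
  by apply: dle_trans (nearQ _ lQ) lx.
have sr : size (rem Q L) = n by rewrite size_rem // sL.
rewrite -sr; apply: IH => //.
  by move=> Q' /mem_rem; apply: cL.
move=> w wp; have [|Q' Q'L nQ'] := nL w.
  by rewrite inE mem_cat wp !orbT.
have nw : ~~ near e M Q w.
  by move: wp; rewrite inE => /orP[/eqP-> //|wp2]; move/allP: al => /(_ w wp2).
exists Q' => //; have [Q'Q|nQ'Q] := eqVneq Q' Q; first by rewrite -Q'Q nQ' in nw.
by move: Q'L; rewrite (perm_mem (perm_to_rem QL)) inE (negPf nQ'Q).
Qed.

Lemma covered_chain e r M N Y (R : rel V) u v : symmetric e -> covered e N Y ->
  (forall a b, R a b -> dle e r a b) ->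
  (forall w, connect R u w -> near e M Y w) ->
  connect R u v -> dle e (N * (2 * M + 1 + r)) u v.
Proof.
move=> se [L [sL cL YL]] Rr nR /connectP[p up ->].
apply: (@dle_mono e (size L * (2 * M + 1 + r))); first by rewrite leq_mul2r sL orbT.
apply: clique_chain => //; first exact: sub_path up.
move=> w wp; have /nearP[y yY wy] : near e M Y w.
  apply: nR; move: wp; rewrite inE => /orP[/eqP->//|wp].
  by case/splitPr: wp up => p1 p2; rewrite cat_path /= => /and3P[up1 lw _];
     apply/connectP; exists (rcons p1 w); rewrite ?rcons_path ?up1 ?last_rcons.
have [Q QL yQ] := YL y yY; exists Q => //; apply/nearP; by exists y.
Qed.

(** Only the ends of a step have to lie in [X] and to share a colour; its length is measured in the
    whole graph [e]. *)
Definition chain (T : eqType) e r (X : {set V}) (c : V -> T) : rel V :=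
  [rel u v | [&& u \in X, v \in X, c u == c v & dle e r u v]].

Lemma chain_sym (T : eqType) e r X (c : V -> T) : symmetric e -> symmetric (chain e r X c).
Proof.
by move=> se u v; rewrite /chain /= (dle_symE se r u v) [c u == _]eq_sym andbCA.
Qed.

Lemma chain_inv (T : eqType) e r X (c : V -> T) u v : u \in X ->
  connect (chain e r X c) u v -> v \in X /\ c v = c u.
Proof.
move=> uX; apply: (@connect_inv _ _ (fun w => w \in X /\ c w = c u)) => //.
by move=> a b [aX <-] /and4P[_ bX /eqP ->].
Qed.

End GraphDistance.

(** * Elimination orders whose bags are covered by few cliques *)

Lemma fin_choice_exists (I : finType) (T : Type) (P : I -> T -> Prop) :
  (forall x, exists y, P x y) -> exists f : I -> T, forall x, P x (f x).
Proof. exact: fin_all_exists. Qed.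

Section Elimination.
Variables (V : finType) (e : rel V) (rho : V -> nat).
Hypothesis se : symmetric e.

(* [rho] is an elimination order: [below x] is the component of [x] among the vertices of
   rank at most [rho x], [sep x] is its outer boundary, and [bag x] plays the role of a bag
   of a tree-decomposition. *)
Definition lowrel s : rel V := [rel a b | [&& e a b, rho a <= s & rho b <= s]].
Definition below x := [set u | connect (lowrel (rho x)) x u].
Definition sep x := [set z | (rho x < rho z) && [exists u in below x, e u z]].
Definition bag x := x |: sep x.

Lemma lowrel_sym s : connect_sym (lowrel s).
Proof. by apply: sym_connect_sym => a b; rewrite /lowrel /= se [X in _ && X]andbC. Qed.

Lemma lowrel_mono s t a b : s <= t -> connect (lowrel s) a b -> connect (lowrel t) a b.
Proof.
move=> st; apply: connect_sub => x y /and3P[xy xs ys].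
by apply: connect1; rewrite /lowrel /= xy !(leq_trans _ st).
Qed.

Lemma below_refl x : x \in below x.
Proof. by rewrite inE. Qed.

Lemma below_rank x u : u \in below x -> rho u <= rho x.
Proof.
rewrite inE => xu.
apply: (connect_inv (I := fun w => rho w <= rho x) _ _ xu); last exact: leqnn.
by move=> a b _; rewrite /lowrel /= => /and3P[].
Qed.

Lemma below_sub x y : y \in below x -> below y \subset below x.
Proof.
move=> yx; have ry := below_rank yx; apply/subsetP => u; rewrite !inE in yx *.
by move=> yu; apply: connect_trans yx (lowrel_mono ry yu).
Qed.

Lemma below_adj x u z : u \in below x -> e u z -> rho z <= rho x -> z \in below x.
Proof.
move=> ux uz zx; have ru := below_rank ux; rewrite !inE in ux *.
by apply: connect_trans ux (connect1 _); rewrite /lowrel /= uz ru.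
Qed.

Lemma sepP x z : reflect (rho x < rho z /\ exists2 u, u \in below x & e u z) (z \in sep x).
Proof.
rewrite inE; apply: (iffP andP) => [[xz /exists_inP[u]]|[xz [u ux uz]]].
  by split=> //; exists u.
by split=> //; apply/exists_inP; exists u.
Qed.

(** A neighbour of the component [below x] outside it has rank above [rho x], hence lies in
    [sep x]. *)
Lemma below_exit x k u v : u \in below x -> v \notin below x -> dle e k u v ->
  exists z a b, [/\ z \in sep x, dle e a u z, dle e b z v & a + b <= k].
Proof.
move=> ux vx uv.
have [w [w' [a [b [wx wx' ww' uw [wv ab]]]]]] := dle_exit uv ux vx.
exists w', a.+1, b; split=> //; last by rewrite addSnnS.
  apply/sepP; split; last by exists w.
  by rewrite ltnNge; apply/negP => /(below_adj wx ww'); apply/negP.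
by rewrite -addn1; apply: dle_trans uw (dle_edge ww').
Qed.

Lemma below_laminar x y u : u \in below x -> u \in below y -> rho x <= rho y ->
  x \in below y.
Proof.
rewrite !inE => xu yu xy; apply: connect_trans yu _.
by rewrite lowrel_sym; apply: lowrel_mono xu.
Qed.

Lemma sep_below x y z : z \in sep x -> x \in below y -> rho z <= rho y -> z \in below y.
Proof.
move=> /sepP[_ [u ux uz]] xy; apply: below_adj uz.
exact: (subsetP (below_sub xy)).
Qed.

Lemma sep_sep x y z : z \in sep x -> x \in below y -> rho y < rho z -> z \in sep y.
Proof.
move=> /sepP[_ [u ux uz]] xy yz; apply/sepP; split=> //; exists u => //.
exact: (subsetP (below_sub xy)).
Qed.

(** Boundary vertices are ancestors of [x] in the elimination forest, ordered by [x \in below z]. *)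
Lemma sep_up x z : z \in sep x -> x \in below z.
Proof.
move=> /sepP[xz [u ux uz]].
have ru := below_rank ux.
have uz' : u \in below z.
  rewrite inE lowrel_sym; apply: connect1; rewrite /lowrel /= uz leqnn andbT.
  by rewrite (leq_trans ru) // ltnW.
by apply: below_laminar ux uz' _; apply: ltnW.
Qed.

Lemma sep_bag x : sep x \subset bag x.
Proof. exact: subsetUr. Qed.

Definition up_closed (X : {set V}) := forall x, x \in X -> sep x \subset X.

End Elimination.

Lemma covered_sub (V : finType) (e : rel V) N (Y Z : {set V}) :
  Z \subset Y -> covered e N Y -> covered e N Z.
Proof.
move=> /subsetP ZY [L [sL cL YL]]; exists L; split=> // z /ZY; exact: YL.
Qed.

(** Every vertex of a clique that meets [Z] is within distance 1 of [Z], hence in [A]. Such cliques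
    vanish with [A], and at least one clique meets [Z]. *)
Lemma covered_remove (V : finType) (e : rel V) N (Y Z A : {set V}) :
  symmetric e -> covered e N.+1 Y ->
  (exists2 y, y \in Y & y \in Z) ->
  (forall a b, a \in Z -> dle e 1 a b -> b \in A) ->
  covered [rel a b | [&& e a b, a \notin A & b \notin A]] N (Y :\: A).
Proof.
move=> se [L [sL cL YL]] [y yY yZ] ZA.
pose P : pred {set V} := fun Q => [disjoint Q & Z].
exists [seq Q :\: A | Q <- filter P L]; split.
- rewrite size_map size_filter -ltnS; apply: leq_trans sL.
  have [Q QL yQ] := YL y yY.
  rewrite -(count_predC P L) -addn1 leq_add2l.
  rewrite -has_count; apply/hasP; exists Q => //=.
  by apply/negP => /pred0P /(_ y) /=; rewrite yQ yZ.
- move=> Q' /mapP[Q]; rewrite mem_filter => /andP[_ QL] -> u v.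
  rewrite !inE => /andP[uA uQ] /andP[vA vQ].
  have := cL _ QL _ _ uQ vQ; case/dle_case=> [->|[w uw]]; first exact: dle_refl.
  by rewrite dle0 => /eqP wv; apply: dle_edge; rewrite /= -wv uw uA wv.
move=> x; rewrite inE => /andP[xA xY]; have [Q QL xQ] := YL x xY.
exists (Q :\: A); last by rewrite inE xA.
apply/mapP; exists Q => //; rewrite mem_filter QL andbT.
apply/pred0P => a /=; apply/negP => /andP[aQ aZ].
by move/negP: xA; apply; apply: ZA aZ _; apply: cL QL _ _ aQ xQ.
Qed.

Local Notation below_in := below.
Local Notation sep_in := sep.
Local Notation bag_in := bag.

(** * The inductive step from bags covered by [N] cliques to bags covered by [N.+1] *)

Section Step.
Variables (V : finType) (e : rel V) (rho : V -> nat) (X : {set V}).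
Hypotheses (se : symmetric e) (rhoI : injective rho) (upX : up_closed e rho X).
Variables (N r D1 : nat).
Local Notation N1 := N.+1.
Hypothesis covX : forall x, x \in X -> covered e N1 (bag e rho x).
(** [CL] bounds a chain staying within [2 * r] of a bag. [R1] leaves room for a jump [r + CL + r]
    across a white shell, and for a step [3 * r] between projections. Farther than [b1] from
    [bag t], walks of length [R1] avoid [A1]. [M] is the reach of a black component whose projection
    comes within [b1] of [bag t]. *)
Let CL := N1 * (2 * (2 * r) + 1 + r).
Let R1 := CL + 3 * r.
Let b1 := 3 * r + 1 + R1.
Let M := D1 + (b1 + 3 * r) + r.
Let D := N1 * (2 * M + 1 + r) + 2 * (2 * r + D1 + CL) .
Hypothesis IHN : forall e1 (X1 : {set V}), symmetric e1 -> up_closed e1 rho X1 ->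
  (forall x, x \in X1 -> covered e1 N (bag e1 rho x)) ->
  exists c : V -> bool, forall u v, u \in X1 -> connect (chain e1 R1 X1 c) u v ->
    dle e1 D1 u v.

Local Notation below := (below e rho).
Local Notation sep := (sep e rho).
Local Notation bag := (bag e rho).

Definition core t := [set u in X | (u \in below t) && ~~ near e r (sep t) u].

(* Close to [sep t] the colours [g] are prescribed; a white ([true]) shell and then a black
   shell keep the chains on both sides apart. *)
Definition good t (g c : V -> bool) := [/\
  forall u, u \in X -> u \in below t -> near e r (sep t) u -> c u = g u,
  forall u, u \in X -> u \in below t -> ~~ near e r (sep t) u ->
    near e (2 * r) (sep t) u -> c u = true,
  forall u, u \in X -> u \in below t -> ~~ near e (2 * r) (sep t) u ->
    near e (3 * r) (sep t) u -> c u = false &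
  forall u v, u \in core t -> connect (chain e r (core t) c) u v -> dle e D u v].

Section Inner.
Variables (t : V) (g : V -> bool).
Hypothesis tX : t \in X.
Let A0 := [set v | near e (3 * r) (bag t) v].
Let A1 := [set v | near e (3 * r + 1) (bag t) v].
(* Below [t] but not below a cut vertex, every bag meets [A0], so removing [A1] leaves one
   clique less; below a cut vertex, recursion on the rank applies. *)
Let cut x := [&& x \in X, x \in below t & [disjoint bag x & A0]].
Hypothesis IH : forall x, x \in X -> rho x < rho t ->
  forall g', exists c, good x g' c.

Let deep x := [exists y, cut y && (x \in below y)].

Lemma cut_lt y : cut y -> rho y < rho t.
Proof.
case/and3P=> yX yt dy; rewrite ltn_neqAle (below_rank yt) andbT.
apply/eqP => /rhoI E; move/pred0P: dy => /(_ t) /= /negP; apply.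
rewrite E setU11 inE; apply/nearP; exists t; rewrite ?setU11 //; exact: dle_refl.
Qed.

Lemma sig_ex : exists s : V -> V, forall x, deep x -> [/\ cut (s x), x \in below (s x) &
  forall y, cut y -> x \in below y -> rho y <= rho (s x)].
Proof.
apply: (fin_all_exists (P := fun x y => deep x -> [/\ cut y, x \in below y &
  forall y', cut y' -> x \in below y' -> rho y' <= rho y])) => x.
have [dx|nd] := boolP (deep x); last by exists x.
have /existsP[y0 Py0] := dx.
case: (arg_maxnP (P := fun y => cut y && (x \in below y)) rho Py0) => y /andP[cy xy] my.
by exists y => _; split=> // y' cy' xy'; apply: my; rewrite cy'.
Qed.

Section WithSigma.
Variable s : V -> V.
Hypothesis sP : forall x, deep x -> [/\ cut (s x), x \in below (s x) &
  forall y, cut y -> x \in below y -> rho y <= rho (s x)].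

(** The sets [below] are laminar, so the highest cut vertex above [x] is also the highest one above
    everything that lies below it. *)
Lemma sig_same x u : deep x -> u \in below (s x) -> deep u /\ s u = s x.
Proof.
move=> dx us; have [cx xsx mx] := sP dx.
have du : deep u by apply/existsP; exists (s x); rewrite cx.
have [cu usu mu] := sP du; split=> //; apply: rhoI.
have le1 := mu _ cx us.
have sxu := below_laminar se us usu le1.
apply/eqP; rewrite eqn_leq le1 andbT; apply: mx => //.
exact: (subsetP (below_sub sxu)).
Qed.

(** The bag of the cut vertex [s x] avoids [A0], so its boundary lies below [t]; otherwise it would
    meet [sep t]. A deep boundary vertex would lie below a cut vertex of larger rank than [s x],
    also above [x], against maximality. *)
Lemma sep_sig x z : deep x -> z \in sep (s x) ->
  [/\ z \in X, z \in below t, ~~ deep z & ~~ near e (3 * r) (bag t) z].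
Proof.
move=> dx zs; have [cx xsx mx] := sP dx.
have /and3P[sX st ds] := cx.
have nz : ~~ near e (3 * r) (bag t) z.
  apply/negP => nz; move/pred0P: ds => /(_ z) /= /negP; apply.
  by rewrite (subsetP (sep_bag _ _ _)) // inE.
split=> //; first exact: (subsetP (upX sX)).
  have [zt|tz] := leqP (rho z) (rho t); first exact: sep_below zs st zt.
  have zt := sep_sep zs st tz; case/negP: nz; apply/nearP; exists z; last exact: dle_refl.
  exact: (subsetP (sep_bag _ _ _)).
apply/negP => /existsP[y /andP[cy zy]].
have sy : s x \in below y by apply: (subsetP (below_sub zy)); exact: sep_up.
have := mx _ cy (subsetP (below_sub sy) _ xsx).
have := below_rank zy; case/sepP: zs => lt _; ar.
Qed.

(** The shallow part away from [bag t]: it is coloured by the induction on the number of cliques, in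
    the graph without [A1]. Deep vertices are left to the induction on the rank. *)
Let X1 := [set x in X | [&& x \in below t, ~~ deep x & x \notin A1]].
Let e1 : rel V := [rel a b | [&& e a b, a \notin A1 & b \notin A1]].

Lemma e1_sym : symmetric e1.
Proof. by move=> a b; rewrite /e1 /= se [X in _ && X]andbC. Qed.

Lemma below_e1 x u : x \notin A1 -> u \in below_in e1 rho x -> u \in below x /\ u \notin A1.
Proof.
move=> xA; rewrite inE => xu.
apply: (connect_inv (I := fun u => u \in below x /\ u \notin A1) _ _ xu).
  move=> a b [ax aA] /and3P[/and3P[ab _ bA] _ bx]; split=> //.
  exact: below_adj ab bx.
by split=> //; apply: below_refl.
Qed.

Lemma sep_e1 x z : x \notin A1 -> z \in sep_in e1 rho x -> z \in sep x /\ z \notin A1.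
Proof.
move=> xA /sepP[xz [u ux /and3P[uz _ zA]]]; split=> //.
by apply/sepP; split=> //; exists u => //; have [] := below_e1 xA ux.
Qed.

Lemma bag_A1 z : z \in bag t -> z \in A1.
Proof. by move=> zt; rewrite inE; apply/nearP; exists z => //; apply: dle_refl. Qed.

Lemma X1_closed : up_closed e1 rho X1.
Proof.
move=> x; rewrite inE => /and4P[xX xt nd xA]; apply/subsetP => z /(sep_e1 xA)[zx zA].
rewrite inE (subsetP (upX xX) _ zx) zA andbT /=.
have [zt|tz] := leqP (rho z) (rho t); last first.
  case/negP: zA; apply: bag_A1; apply: (subsetP (sep_bag _ _ _)).
  exact: sep_sep zx xt tz.
rewrite (sep_below zx xt zt) /=; apply/negP => /existsP[y /andP[cy zy]].
case/negP: nd; apply/existsP; exists y; rewrite cy /=.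
exact: (subsetP (below_sub zy)) (sep_up _ zx).
Qed.

(** As [x] is not a cut vertex, its bag meets [A0], and [A1] contains all vertices within distance 1
    of [A0]; so one clique is lost. *)
Lemma X1_covered x : x \in X1 -> covered e1 N (bag_in e1 rho x).
Proof.
rewrite inE => /and4P[xX xt nd xA].
have [/pred0P ncut|] := boolP [disjoint bag x & A0].
  case/negP: nd; apply/existsP; exists x; rewrite below_refl andbT /cut xX xt /=.
  exact/pred0P.
case/pred0Pn=> y /= /andP[yx yA].
apply: (covered_sub (Y := bag x :\: A1)).
  apply/subsetP => z; rewrite in_setU1 => /orP[/eqP->|/(sep_e1 xA)[zx zA]].
    by rewrite inE xA setU11.
  by rewrite inE zA (subsetP (sep_bag _ _ _)).
apply: covered_remove (covX xX) _ _ => //.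
  by exists y; [exact: yx|exact: yA].
move=> a b; rewrite !inE [_ + 1]addnC => na ab; apply: near_step na; exact: dle_sym.
Qed.


Section Gluing.
Variables (p : V -> V) (c1 : V -> bool) (cs : V -> V -> bool).
Hypothesis pN : forall x, ~~ deep x -> p x = x.
Hypothesis pD : forall x, deep x -> near e r (sep (s x)) x ->
  p x \in sep (s x) /\ dle e r x (p x).
Hypothesis c1P : forall u v, u \in X1 -> connect (chain e1 R1 X1 c1) u v ->
  dle e1 D1 u v.
(* A vertex below a maximal cut vertex [s x] and close to [sep (s x)] takes the colour of its
   projection [p x] to [sep (s x)]. *)
Let cbar v := if near e r (sep t) v then g v else
  if near e (2 * r) (sep t) v then true else
  if near e b1 (bag t) v then false else c1 v.
Hypothesis csP : forall y, cut y -> good y (cbar \o p) (cs y).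
Let c x := if deep x then cs (s x) x else cbar x.
(** Deep vertices form three zones by distance to [sep (s x)]: up to [r] the colour comes from the
    projection, up to [2 * r] it is white, and beyond that the vertex is [locked]. Shallow vertices
    and the first zone make up [goodpt]. *)
Let goodpt x := ~~ deep x || near e r (sep (s x)) x.
Let locked x := deep x && ~~ near e (2 * r) (sep (s x)) x.
Local Notation K := (core t).
Local Notation Rc := (chain e r K c).
Local Notation chain1 := (chain e1 R1 X1 c1).

Lemma coreP x u : u \in core x ->
  [/\ u \in X, u \in below x & ~~ near e r (sep x) u].
Proof. by rewrite inE => /and3P. Qed.

Lemma mem_core x u : u \in X -> u \in below x -> ~~ near e r (sep x) u -> u \in core x.
Proof. by move=> uX ux nu; rewrite inE uX ux. Qed.

(** A walk from a deep [u] to [sep t] crosses [sep (s u)], whose vertices are more than [3 * r] away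
    from [bag t]. *)
Lemma near_shallow u k : k <= 3 * r -> near e k (sep t) u -> ~~ deep u.
Proof.
move=> kr /nearP[z zt uz]; apply/negP => du; have [cu usu _] := sP du.
have /and3P[_ st _] := cu.
have zs : z \notin below (s u).
  apply/negP => /(subsetP (below_sub st)) /below_rank; case/sepP: zt => zt _; ar.
have [y [a [b [ys _ yz ab]]]] := below_exit usu zs uz.
have [_ _ _ /negP[]] := sep_sig du ys; apply/nearP; exists z.
  exact: (subsetP (sep_bag _ _ _)).
by apply: dle_mono yz; ar.
Qed.

Lemma c_shell1 u : near e r (sep t) u -> c u = g u.
Proof.
by move=> nu; rewrite /c ifN ?(near_shallow _ nu) //; [rewrite /cbar nu|ar].
Qed.

Lemma c_shell2 u : ~~ near e r (sep t) u -> near e (2 * r) (sep t) u -> c u = true.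
Proof.
move=> nu n2; rewrite /c ifN ?(near_shallow _ n2) //; last ar.
by rewrite /cbar (negPf nu) n2.
Qed.

Lemma c_shell3 u : ~~ near e (2 * r) (sep t) u -> near e (3 * r) (sep t) u ->
  c u = false.
Proof.
move=> nu n3; rewrite /c ifN ?(near_shallow _ n3) //.
rewrite /cbar (negPf nu) ifN; last first.
  by apply: contra nu; apply: near_mono => //; ar.
by rewrite ifT //; apply: near_mono n3; rewrite ?sep_bag // /b1; ar.
Qed.

Lemma goodptP u : u \in X -> u \in below t -> goodpt u ->
  [/\ p u \in X, p u \in below t, ~~ deep (p u), dle e r u (p u) & c u = cbar (p u)].
Proof.
move=> uX ut; rewrite /goodpt; have [du /= nu|nd _] := boolP (deep u); last first.
  by rewrite pN // /c (negPf nd); split=> //; apply: dle_refl.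
have [pu upu] := pD du nu; have [pX pt npd _] := sep_sig du pu.
split=> //; rewrite /c du; have [cu usu _] := sP du.
by have [-> ] := csP cu.
Qed.

Lemma cbar_far v : ~~ near e b1 (bag t) v -> cbar v = c1 v.
Proof.
move=> nv; have n k : k <= b1 -> near e k (sep t) v = false.
  move=> kb; apply/negbTE; apply: contra nv.
  by apply: near_mono => //; apply: sep_bag.
by rewrite /cbar (negPf nv) !n // /b1; ar.
Qed.

Lemma far_X1 w : w \in X -> w \in below t -> goodpt w ->
  ~~ near e b1 (bag t) (p w) -> p w \in X1.
Proof.
move=> wX wt gw far; have [pX pt pd _ _] := goodptP wX wt gw.
rewrite inE pX pt pd /= inE; apply: contra far.
by apply: near_mono => //; rewrite /b1; ar.
Qed.

(** A walk of length at most [R1] that starts farther than [b1] from [bag t] cannot reach [A1], so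
    it survives in [e1]. *)
Lemma link1 a b k : k <= R1 -> a \in X1 -> b \in X1 -> ~~ near e b1 (bag t) a ->
  c1 a = c1 b -> dle e k a b -> chain1 a b.
Proof.
move=> kR aX bX fa cab ab; rewrite /chain /= aX bX cab eqxx /=.
apply: (dle_avoid (P := fun w => w \notin A1)); last exact: dle_mono ab.
move=> w aw; apply: contra fa; rewrite inE => nw.
by apply: near_mono (near_step aw nw) => //; rewrite /b1; ar.
Qed.

Lemma chain1_dle u v : u \in X1 -> connect chain1 u v -> dle e D1 u v.
Proof. by move=> uX /(c1P uX); apply: dle_sub => a b /and3P[]. Qed.

(** From beyond [2 * r] an [r]-step cannot cross [sep (s a)]. If it ended within [2 * r] of it, it
    would lead from the black shell into the white one, which changes the colour. *)
Lemma lock_step a b : Rc a b -> locked a -> [/\ locked b, s b = s a &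
  chain e r (core (s a)) (cs (s a)) a b].
Proof.
move=> /and4P[/coreP[aX at_ na] /coreP[bX bt nb] /eqP cab ab] /andP[da n2a].
have [ca asa _] := sP da.
have bsa : b \in below (s a).
  apply/negPn/negP => nbs; have [z [k [l [zs az _ kl]]]] := below_exit asa nbs ab.
  case/negP: n2a; apply/nearP; exists z => //; apply: dle_mono az; ar.
have [db sb] := sig_same da bsa.
have nrb : ~~ near e r (sep (s a)) b.
  by apply: contra n2a => /(near_step ab); apply: near_mono => //; ar.
have [_ cs2 cs3 _] := csP ca.
have n2b : ~~ near e (2 * r) (sep (s a)) b.
  apply/negP => n2b; move: cab; rewrite /c da db sb (cs2 b) // cs3 //.
  by apply: near_mono (near_step ab n2b) => //; ar.
split=> //; first by rewrite /locked db sb.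
have nra : ~~ near e r (sep (s a)) a.
  by apply: contra n2a; apply: near_mono => //; ar.
rewrite /chain /= !mem_core //= ab andbT.
by move: cab; rewrite /c da db sb => ->.
Qed.

Lemma locked_bound u v : u \in K -> locked u -> connect Rc u v -> dle e D u v.
Proof.
move=> uK lu uv.
have [_ _ con] : [/\ locked v, s v = s u &
    connect (chain e r (core (s u)) (cs (s u))) u v].
  apply: (connect_inv (I := fun w => [/\ locked w, s w = s u &
    connect (chain e r (core (s u)) (cs (s u))) u w]) _ _ uv) => //.
  move=> a b [la sa ua] ab; have [lb sb ch] := lock_step ab la.
  by split=> //; [rewrite sb|apply: connect_trans ua (connect1 _); rewrite -sa].
have /andP[du n2u] := lu; have [cu usu _] := sP du.
have [_ _ _] := csP cu; apply=> //; have [uX _ _] := coreP uK.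
by apply: mem_core => //; apply: contra n2u; apply: near_mono => //; ar.
Qed.

Lemma unlocked_all u : ~~ locked u -> forall w, connect Rc u w -> ~~ locked w.
Proof.
move=> nu w; apply: (connect_inv (I := fun w => ~~ locked w)) => // a b na ab.
apply: contra na => lb; have [] := lock_step (a := b) (b := a) _ lb => //.
by rewrite chain_sym.
Qed.

Lemma shell2P w : ~~ locked w -> ~~ goodpt w ->
  [/\ deep w, ~~ near e r (sep (s w)) w & near e (2 * r) (sep (s w)) w].
Proof.
by rewrite /locked /goodpt negb_or negbK => nl /andP[dw nw]; rewrite dw negbK in nl.
Qed.

Lemma shell2_c w : w \in X -> ~~ locked w -> ~~ goodpt w -> c w = true.
Proof.
move=> wX nl ng; have [dw n1 n2] := shell2P nl ng.
by rewrite /c dw; have [cw wsw _] := sP dw; have [_ -> ] := csP cw.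
Qed.

Lemma comp_core u w : u \in K -> connect Rc u w ->
  [/\ w \in X, w \in below t, ~~ near e r (sep t) w & c w = c u].
Proof. by move=> uK /(chain_inv uK)[/coreP[]]. Qed.

Lemma Rc_sym : connect_sym Rc.
Proof. by apply: sym_connect_sym; apply: chain_sym. Qed.

Lemma Rc_dle a b : Rc a b -> dle e r a b.
Proof. by case/and4P. Qed.

Lemma cov_t : covered e N1 (bag t).
Proof. exact: covX. Qed.

(** A black component avoids the white shells, so all its vertices project to shallow vertices at
    distance at most [r]. Either no projection comes within [b1] of [bag t], and the projections
    form a chain for [c1]; or the component stays within [M] of [bag t], whose clique cover bounds
    it. *)
Lemma black_bound u v : u \in K -> ~~ locked u -> c u = false ->
  connect Rc u v -> dle e D u v.
Proof.
move=> uK nlu cu uv.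
have gp w : connect Rc u w -> goodpt w.
  move=> uw; have [wX _ _ cw] := comp_core uK uw.
  apply/negPn/negP => ng; move: cw; rewrite shell2_c ?cu //.
  exact: unlocked_all uw.
have info w : connect Rc u w -> [/\ goodpt w, w \in X, w \in below t,
    dle e r w (p w) & cbar (p w) = false].
  move=> uw; have [wX wt _ cw] := comp_core uK uw; have gw := gp w uw.
  by have [_ _ _ wp cE] := goodptP wX wt gw; split=> //; rewrite -cE cw.
have far w : connect Rc u w -> ~~ near e b1 (bag t) (p w) ->
    p w \in X1 /\ c1 (p w) = false.
  move=> uw fw; have [gw wX wt wp cw] := info w uw.
  by split; [exact: far_X1|rewrite -cbar_far].
have st a b : connect Rc u a -> Rc a b -> dle e (3 * r) (p a) (p b).
  move=> ua ab; have ub := connect_trans ua (connect1 ab).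
  have [_ _ _ ap _] := info a ua; have [_ _ _ bp _] := info b ub.
  apply: (@dle_mono _ e (r + r + r)); first ar.
  exact: dle_trans (dle_trans (dle_sym se ap) (Rc_dle ab)) bp.
have [/existsP[w /andP[uw nw]]|nex] :=
  boolP [exists w, connect Rc u w && near e b1 (bag t) (p w)].
  (* [w1] is where the current excursion away from [bag t] began. Along it the projections form a
     chain for [c1], so it reaches no farther than [D1]. *)
  pose I x := connect Rc u x /\ (near e b1 (bag t) (p x) \/
      exists w1, [/\ near e (b1 + 3 * r) (bag t) w1, w1 \in X1 & connect chain1 w1 (p x)]).
  have Ix x : connect Rc w x -> I x.
    move=> wx; apply: (connect_inv (I := I) _ _ wx); last by split=> //; left.
    move=> a b [ua Ia] ab; have ub := connect_trans ua (connect1 ab); split=> //.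
    have [nb|fb] := boolP (near e b1 (bag t) (p b)); [by left|right].
    have [bX cb] := far b ub fb; have ba := dle_sym se (st a b ua ab).
    have [na|fa] := boolP (near e b1 (bag t) (p a)).
      exists (p b); split=> //; apply: near_mono (near_step ba na) => //; ar.
    case: Ia => [na|[w1 [n1 w1X con]]]; first by rewrite na in fa.
    have [aX ca] := far a ua fa.
    exists w1; split=> //; apply: connect_trans con (connect1 _).
    apply: link1 (st a b ua ab) => //; last by rewrite ca.
    by rewrite /R1; ar.
  have nM x : connect Rc u x -> near e M (bag t) x.
    move=> ux; have [_ _ _ xp _] := info x ux.
    have wx : connect Rc w x by rewrite Rc_sym in uw; apply: connect_trans uw ux.
    have [_ [n1|[w1 [n1 w1X con]]]] := Ix x wx.
      by apply: near_mono (near_step xp n1) => //; rewrite /M; ar.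
    have := near_step (dle_sym se (chain1_dle w1X con)) n1.
    by move/(near_step xp); apply: near_mono => //; rewrite /M; ar.
  apply: (@dle_mono _ e (N1 * (2 * M + 1 + r))); first by rewrite /D; ar.
  exact: (covered_chain (R := Rc) se cov_t Rc_dle nM uv).
have {}nex w : connect Rc u w -> ~~ near e b1 (bag t) (p w).
  by move=> uw; apply: contra nex => nw; apply/existsP; exists w; rewrite uw.
have [_ con] : connect Rc u v /\ connect chain1 (p u) (p v).
  apply: (connect_inv (I := fun w => connect Rc u w /\ connect chain1 (p u) (p w))
    _ _ uv); last by [].
  move=> a b [ua con] ab; have ub := connect_trans ua (connect1 ab); split=> //.
  have [aX ca] := far a ua (nex a ua); have [bX cb] := far b ub (nex b ub).
  apply: connect_trans con (connect1 _).
  apply: link1 (st a b ua ab) => //; [by rewrite /R1; ar|exact: nex|by rewrite ca].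
have u0 : connect Rc u u by [].
have [uX _] := far u u0 (nex u u0).
have [_ _ _ up _] := info u u0; have [_ _ _ vp _] := info v uv.
apply: dle_mono (dle_trans (dle_trans up (chain1_dle uX con)) (dle_sym se vp)).
by rewrite /D; ar.
Qed.

Lemma near2_bound x u v (S : {set V}) (R : rel V) : x \in X -> S = sep x ->
  (forall a b, R a b -> dle e r a b) ->
  (forall w, connect R u w -> near e (2 * r) S w) -> connect R u v -> dle e CL u v.
Proof.
move=> xX -> Rr nR uv; apply: covered_chain Rr nR uv => //.
exact: covered_sub (sep_bag _ _ _) (covX xX).
Qed.


Lemma shell2_comp u w : u \in K -> c u = true -> near e (2 * r) (sep t) u ->
  connect Rc u w -> near e (2 * r) (sep t) w.
Proof.
move=> uK cu n2u uw.
suff [] : connect Rc u w /\ near e (2 * r) (sep t) w by [].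
apply: (connect_inv (I := fun w => connect Rc u w /\ near e (2 * r) (sep t) w)
  _ _ uw); last by [].
move=> a b [ua na] ab; have ub := connect_trans ua (connect1 ab); split=> //.
have [_ _ _ cb] := comp_core uK ub.
apply: contraT => nb; move: cb; rewrite cu c_shell3 //.
apply: near_mono (near_step (dle_sym se (Rc_dle ab)) na) => //; ar.
Qed.

Lemma shell2_below a b : Rc a b -> ~~ locked a -> ~~ goodpt a -> b \in below (s a).
Proof.
move=> ab nl ng; have [da n1 _] := shell2P nl ng; have [_ asa _] := sP da.
apply/negPn/negP => nbs.
have [z [k [l [zs az _ kl]]]] := below_exit asa nbs (Rc_dle ab).
case/negP: n1; apply/nearP; exists z => //; apply: dle_mono az; ar.
Qed.

(** Within [2 * r] of [sep t] the component is confined by the black shell. Elsewhere its good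
    vertices project to vertices coloured by [c1], and an excursion through a white shell stays near
    a single separator. It therefore spans at most [CL], and consecutive projections are at distance
    at most [R1]. *)
Lemma white_bound u v : u \in K -> ~~ locked u -> c u = true ->
  connect Rc u v -> dle e D u v.
Proof.
move=> uK nlu cu uv.
have nl w : connect Rc u w -> ~~ locked w by apply: unlocked_all.
have [n2u|f2u] := boolP (near e (2 * r) (sep t) u).
  apply: (@dle_mono _ e CL); first by rewrite /D; ar.
  apply: (near2_bound tX erefl Rc_dle _ uv) => w; exact: shell2_comp.
have f2 w : connect Rc u w -> ~~ near e (2 * r) (sep t) w.
  move=> uw; have [wK cw] := chain_inv uK uw.
  apply: contra f2u => nw; apply: shell2_comp wK _ nw _; first by rewrite cw.
  by rewrite Rc_sym.
have good_info w : connect Rc u w -> goodpt w ->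
    [/\ p w \in X1, c1 (p w) = true, ~~ near e b1 (bag t) (p w) & dle e r w (p w)].
  move=> uw gw; have [wX wt n1w cw] := comp_core uK uw.
  have [_ _ _ wp cE] := goodptP wX wt gw.
  have far : ~~ near e b1 (bag t) (p w).
    apply/negP => nb; move: cE; rewrite cw cu /cbar nb.
    suff [/negPf-> /negPf-> //] : ~~ near e r (sep t) (p w) /\
        ~~ near e (2 * r) (sep t) (p w).
    have [dw|nd] := boolP (deep w); last by rewrite pN // f2.
    have nw : near e r (sep (s w)) w by move: gw; rewrite /goodpt dw.
    have [pw _] := pD dw nw; have [_ _ _ n3] := sep_sig dw pw.
    by split; apply: contra n3; apply: near_mono; rewrite ?sep_bag //; ar.
  by split=> //; [exact: far_X1|rewrite -cbar_far // -cE cw].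
have [/existsP[w0 /andP[uw0 g0]]|nex] := boolP [exists w, connect Rc u w && goodpt w].
  suff B w : connect Rc u w -> dle e (2 * r + D1 + CL) w0 w.
    apply: dle_mono (dle_trans (dle_sym se (B u _)) (B v uv)) => //.
    by rewrite /D; ar.
  move=> uw; have w0w : connect Rc w0 w by rewrite Rc_sym in uw0; apply: connect_trans uw0 uw.
  (* Steps inside the [2 * r]-neighbourhood of one separator; the clique cover of that bag bounds
     their chains by [CL]. *)
  pose S2 x : rel V := [rel a b | [&& dle e r a b, near e (2 * r) (sep (s x)) a &
    near e (2 * r) (sep (s x)) b]].
  have S2b x a b : deep x -> near e (2 * r) (sep (s x)) a -> connect (S2 x) a b ->
      dle e CL a b.
    move=> dx na; have [cx _ _] := sP dx; have /and3P[sX _ _] := cx.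
    apply: (near2_bound sX erefl); first by move=> ? ? /and3P[].
    move=> y ay; apply: (connect_inv (I := fun y => near e (2 * r) (sep (s x)) y) _ _ ay) => //.
    by move=> ? ? _ /and3P[].
  (* [wi] is the good vertex from which the current excursion entered the white shell. *)
  pose I x := connect Rc u x /\ (if goodpt x then is_true (connect chain1 (p w0) (p x)) else
    exists wi, [/\ connect Rc u wi, goodpt wi, deep wi /\ s wi = s x,
      connect chain1 (p w0) (p wi) & connect (S2 x) wi x]).
  have Iw : I w.
    apply: (connect_inv (I := I) _ _ w0w); last by rewrite /I g0.
    move=> a b [ua Ia] ab; have ub := connect_trans ua (connect1 ab); split=> //.
    move: Ia; case ga: (goodpt a) => Ia.
      have [aX ca fa ap] := good_info a ua ga.
      have [gb|ngb] := boolP (goodpt b).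
        have [bX cb _ bp] := good_info b ub gb.
        apply: connect_trans Ia (connect1 _).
        apply: link1 (dle_trans (dle_trans (dle_sym se ap) (Rc_dle ab)) bp) => //.
          by rewrite /R1; ar.
        by rewrite ca.
      have ba : Rc b a by rewrite chain_sym.
      have asb := shell2_below ba (nl b ub) ngb.
      have [db n1b n2b] := shell2P (nl b ub) ngb.
      have [da sa] := sig_same db asb.
      exists a; split=> //; apply: connect1; rewrite /S2 /= (Rc_dle ab) n2b andbT.
      move: ga; rewrite /goodpt da /= sa; apply: near_mono => //; ar.
    case: Ia => wi [uwi gi [di si] con ch].
    have nga : ~~ goodpt a by rewrite ga.
    have bsa := shell2_below ab (nl a ua) nga.
    have [da n1a n2a] := shell2P (nl a ua) nga.
    have [db sb] := sig_same da bsa.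
    have S2E : S2 b = S2 a by rewrite /S2 sb.
    have n2b : near e (2 * r) (sep (s a)) b.
      by have := nl b ub; rewrite /locked db negbK sb.
    have chb : connect (S2 a) wi b.
      apply: connect_trans ch (connect1 _); by rewrite /S2 /= (Rc_dle ab) n2a.
    case gb: (goodpt b); last by exists wi; rewrite S2E si sb.
    have [bX cb _ bp] := good_info b ub gb.
    have [iX ci fi ip] := good_info wi uwi gi.
    have n2i : near e (2 * r) (sep (s a)) wi.
      rewrite -si; move: gi; rewrite /goodpt di /=; apply: near_mono => //; ar.
    have wib := S2b a wi b da n2i chb.
    apply: connect_trans con (connect1 _).
    apply: link1 (dle_trans (dle_trans (dle_sym se ip) wib) bp) => //.
      by rewrite /R1; ar.
    by rewrite ci.
  have [p0X _ _ w0p] := good_info w0 uw0 g0.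
  have [_] := Iw; case: ifPn => gw; [move=> con|case=> wi [uwi gi [di si] con ch]].
    have [_ _ _ wp] := good_info w uw gw.
    apply: dle_mono (dle_trans (dle_trans w0p (chain1_dle p0X con)) (dle_sym se wp)).
    by ar.
  have [_ _ _ ip] := good_info wi uwi gi.
  have [dw n1w n2w] := shell2P (nl w uw) gw.
  have n2i : near e (2 * r) (sep (s w)) wi.
    rewrite -si; move: gi; rewrite /goodpt di /=; apply: near_mono => //; ar.
  apply: dle_mono (dle_trans (dle_trans (dle_trans w0p (chain1_dle p0X con))
    (dle_sym se ip)) (S2b w wi w dw n2i ch)); ar.
(* Without good vertices the component lies in one white shell. *)
have ng w : connect Rc u w -> ~~ goodpt w.
  by move=> uw; apply: contra nex => gw; apply/existsP; exists w; rewrite uw.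
have u0 : connect Rc u u by [].
have [du _ _] := shell2P (nl u u0) (ng u u0).
have [cx _ _] := sP du; have /and3P[sX _ _] := cx.
apply: (@dle_mono _ e CL); first by rewrite /D; ar.
apply: (near2_bound sX erefl Rc_dle _ uv) => w uw.
have [_ <-] : connect Rc u w /\ s w = s u; last first.
  by have [] := shell2P (nl w uw) (ng w uw).
apply: (connect_inv (I := fun w => connect Rc u w /\ s w = s u) _ _ uw) => //.
move=> a b [ua sa] ab; split; first exact: connect_trans ua (connect1 ab).
have [da _ _] := shell2P (nl a ua) (ng a ua).
by have [_ ->] := sig_same da (shell2_below ab (nl a ua) (ng a ua)).
Qed.

Lemma good_glue : good t g c.
Proof.
split=> [u _ _|u _ _|u _ _|u v uK uv]; [exact: c_shell1|exact: c_shell2|exact: c_shell3|].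
have [lu|nl] := boolP (locked u); first exact: locked_bound uv.
by case cu: (c u); [apply: white_bound uv|apply: black_bound uv].
Qed.

End Gluing.
End WithSigma.

Lemma good_exists : exists c, good t g c.
Proof.
have [s sP] := sig_ex.
have [c1 c1P] := IHN e1_sym X1_closed X1_covered.
have [p pP] : exists p : V -> V, forall x, (~~ deep x -> p x = x) /\
    (deep x -> near e r (sep (s x)) x -> p x \in sep (s x) /\ dle e r x (p x)).
  apply: (fin_all_exists (P := fun x y => (~~ deep x -> y = x) /\
    (deep x -> near e r (sep (s x)) x -> y \in sep (s x) /\ dle e r x y))) => x.
  have [dx|nd] := boolP (deep x); last by exists x.
  have [/nearP[y ys xy]|nn] := boolP (near e r (sep (s x)) x); first by exists y.
  by exists x.
pose cbar v := if near e r (sep t) v then g v else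
  if near e (2 * r) (sep t) v then true else
  if near e b1 (bag t) v then false else c1 v.
have [cs csP] : exists cs : V -> V -> bool, forall y, cut y -> good y (cbar \o p) (cs y).
  apply: (fin_choice_exists (P := fun y c => cut y -> good y (cbar \o p) c)) => y.
  have [cy|nc] := boolP (cut y); last by exists (fun _ => true).
  have /and3P[yX _ _] := cy; have [c] := IH yX (cut_lt cy) (cbar \o p).
  by exists c.
exists (fun x => if deep x then cs (s x) x else cbar x).
apply: (good_glue sP (p := p) (c1 := c1) (cs := cs)) => //.
- by move=> x; case: (pP x).
- by move=> x; case: (pP x).
Qed.

End Inner.

(** Induction on the rank, with [g] universally quantified because each recursive call prescribes
    other colours near its separator. *)
Lemma good_all t g : t \in X -> exists c, good t g c.
Proof.
have [n] := ubnP (rho t); elim: n t g => // n IH t g tn tX.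
apply: good_exists => // x xX xt g'; apply: IH => //; ar.
Qed.

(** [s x] is the highest vertex of [X] above [x]. As [X] is up-closed, [sep (s x)] is empty, so
    chains never leave [below (s x)] and [good_all] applies to each such root. *)
Lemma elimination_step : exists c : V -> bool, forall u v, u \in X ->
  connect (chain e r X c) u v -> dle e D u v.
Proof.
have [s sP] : exists s : V -> V, forall x, x \in X -> [/\ s x \in X, x \in below (s x) &
    forall y, y \in X -> x \in below y -> rho y <= rho (s x)].
  apply: (fin_all_exists (P := fun x z => x \in X -> [/\ z \in X, x \in below z &
    forall y, y \in X -> x \in below y -> rho y <= rho z])) => x.
  have [xX|] := boolP (x \in X); last by exists x.
  have Px : (x \in X) && (x \in below x) by rewrite xX below_refl.
  case: (arg_maxnP (P := fun y => (y \in X) && (x \in below y)) rho Px) => y /andP[cy xy] my.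
  by exists y => _; split=> // y' cy' xy'; apply: my; rewrite cy'.
have [cs csP] : exists cs : V -> V -> bool, forall y, y \in X ->
    good y (fun _ => true) (cs y).
  apply: (fin_choice_exists (P := fun y c => y \in X -> good y (fun _ => true) c)) => y.
  have [yX|ny] := boolP (y \in X); last by exists (fun _ => true).
  by have [c] := good_all (fun _ => true) yX; exists c.
have sep0 x : x \in X -> sep (s x) = set0.
  move=> xX; have [sX xs mx] := sP x xX; apply/eqP/set0Pn => -[z zs].
  have := mx z (subsetP (upX sX) z zs) (subsetP (below_sub (sep_up se zs)) _ xs).
  by case/sepP: zs; ar.
have step x y : x \in X -> y \in X -> dle e r x y -> s y = s x.
  move=> xX yX xy; have [sX xs mx] := sP x xX; have [sY ys my] := sP y yX.
  have yx : y \in below (s x).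
    apply/negPn/negP => nb; have [z [a [b []]]] := below_exit xs nb xy.
    by rewrite sep0 // inE.
  apply: rhoI; apply/eqP; rewrite eqn_leq my // andbT; apply: mx => //.
  have le1 := my _ sX yx.
  exact: (subsetP (below_sub (below_laminar se yx ys le1))).
exists (fun x => cs (s x) x) => u v uX uv; have [sX us mu] := sP u uX.
have [_ _ _] := csP _ sX; apply; first by rewrite inE uX us sep0 //= ; apply/nearP => -[y]; rewrite inE.
have [_ _ //] : [/\ v \in X, s v = s u & connect (chain e r (core (s u)) (cs (s u))) u v].
apply: (connect_inv (I := fun v => [/\ v \in X, s v = s u &
  connect (chain e r (core (s u)) (cs (s u))) u v]) _ _ uv) => //.
move=> a b [aX sa con] /and4P[_ bX /eqP cab ab].
have sb : s b = s u by rewrite (step _ _ aX bX ab).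
split=> //; apply: connect_trans con (connect1 _).
have inc w : w \in X -> s w = s u -> w \in core (s u).
  move=> wX sw; rewrite inE wX sep0 //; have [_ ] := sP w wX; rewrite sw => -> _ /=.
  by apply/nearP => -[y]; rewrite inE.
have aK := inc a aX sa; have bK := inc b bX sb; rewrite sa sb in cab.
by rewrite /chain /= aK bK ab cab eqxx.
Qed.

End Step.

Theorem elimination_colouring (N r : nat) : exists D, forall (V : finType) (e : rel V)
    (rho : V -> nat) (X : {set V}),
  symmetric e -> injective rho -> up_closed e rho X ->
  (forall x, x \in X -> covered e N (bag e rho x)) ->
  exists c : V -> bool, forall u v, u \in X -> connect (chain e r X c) u v -> dle e D u v.
Proof.
elim: N r => [|N IHN] r.
  (* A bag contains [x], so it is not covered by zero cliques and [X] is empty. *)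
  exists 0 => V e rho X _ _ _ cov; exists (fun _ => true) => u v uX.
  have [L [sL _ /(_ u)[|Q]]] := cov u uX; first exact: setU11.
  by case: L sL.
(* The recursion is applied at the scale [R1] of the inductive step. *)
have [D1 D1P] := IHN (N.+1 * (2 * (2 * r) + 1 + r) + 3 * r).
eexists => V e rho X se rhoI upX cov.
exact: (elimination_step se rhoI upX cov
  (fun e1 X1 s1 u1 k1 => D1P V e1 rho X1 s1 rhoI u1 k1)).
Qed.

(** * Turning clusters inside bags into cliques *)

Section FillIn.
Variables (V : finType) (e q : rel V) (rho : V -> nat).
Hypotheses (se : symmetric e) (sq : symmetric q).

Definition fill : rel V :=
  [rel u v | e u v || (q u v && [exists x, (u \in bag e rho x) && (v \in bag e rho x)])].

Lemma fill_sym : symmetric fill.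
Proof.
move=> u v; rewrite /fill /= se sq; congr (_ || (_ && _)).
by apply: eq_existsb => x; rewrite andbC.
Qed.

Lemma bag_below x z : z \in bag e rho x -> x \in below e rho z.
Proof. by rewrite in_setU1 => /orP[/eqP->|/(sep_up se)//]; rewrite below_refl. Qed.

(** Every vertex [z] of the bag of [x] is joined to [x] by old edges through ranks at most [rho z].
    So a new edge joins vertices that were already connected at that rank, as in a chordal
    completion. *)
Lemma fill_low s : connect (lowrel fill rho s) =2 connect (lowrel e rho s).
Proof.
move=> u v; apply/idP/idP; apply: connect_sub => {}u {}v; last first.
  by move=> /and3P[uv us vs]; apply: connect1; rewrite /lowrel /fill /= uv us vs.
move=> /and3P[/orP[uv|/andP[_ /existsP[x /andP[ux vx]]]] us vs].
  by apply: connect1; rewrite /lowrel /= uv us vs.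
have up z : z \in bag e rho x -> rho z <= s -> connect (lowrel e rho s) z x.
  by move=> /bag_below; rewrite inE => zx zs; apply: lowrel_mono zx.
by apply: connect_trans (up u ux us) _; rewrite lowrel_sym // up.
Qed.

Lemma fill_below x : below fill rho x = below e rho x.
Proof. by apply/setP => u; rewrite !inE fill_low. Qed.

Lemma fill_sep x : sep fill rho x \subset sep e rho x.
Proof.
apply/subsetP => z /sepP[xz [u]]; rewrite fill_below => ux.
case/orP=> [uz|/andP[_ /existsP[y /andP[uy zy]]]].
  by apply/sepP; split=> //; exists u.
have yx := subsetP (below_sub ux) _ (bag_below uy).
move: zy; rewrite in_setU1 => /orP[/eqP zy|zy]; last exact: sep_sep zy yx xz.
by move: (below_rank yx); rewrite leqNgt -zy xz.
Qed.

End FillIn.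

(** Here [e] will itself consist of long steps, so scale 1 suffices. Clusters of [q] become cliques
    of the filled graph, whose edges belong to [e] or [q]. *)
Theorem elimination_colouring_clusters (N : nat) : exists D, forall (V : finType) (e q : rel V) (rho : V -> nat),
  symmetric e -> symmetric q -> injective rho ->
  (forall x, exists L : seq {set V}, [/\ size L <= N,
     forall Q, Q \in L -> forall u v, u \in Q -> v \in Q -> q u v &
     forall y, y \in bag e rho x -> exists2 Q, Q \in L & y \in Q]) ->
  exists c : V -> bool, forall u v,
    connect [rel a b | (c a == c b) && e a b] u v -> dle (relU e q) D u v.
Proof.
have [D DP] := elimination_colouring N 1; exists D => V e q rho se sq rhoI cov.
have [|||x _|c cP] := DP V (fill e q rho) rho setT.
- exact: fill_sym.
- exact: rhoI.
- by move=> x _; apply: subsetT.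
- have [L [sL LQ Lb]] := cov x.
  exists [seq Q :&: bag e rho x | Q <- L]; split; first by rewrite size_map.
    move=> Q' /mapP[Q QL ->] u v; rewrite !inE => /andP[uQ ux] /andP[vQ vx].
    apply: dle_edge; rewrite /fill /= (LQ _ QL _ _ uQ vQ); apply/orP; right.
    by apply/existsP; exists x; rewrite !inE ux vx.
  move=> y yb; have yb' : y \in bag e rho x.
    move: yb; rewrite !in_setU1 => /orP[->//|/(subsetP (fill_sep q rho se x)) ->].
    by rewrite orbT.
  have [Q QL yQ] := Lb y yb'; exists (Q :&: bag e rho x); last by rewrite inE yQ.
  by apply/mapP; exists Q.
exists c => u v uv; apply: (dle_sub (e := fill e q rho)).
  by move=> a b /orP[ab|/andP[ab _]]; rewrite /= ab ?orbT.
apply: cP => //; apply: connect_sub uv => a b /andP[cab ab].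
by apply: connect1; rewrite /chain /= !inE cab; apply: dle_edge; rewrite /fill /= ab.
Qed.

(** * Gluing blocks of levels *)

Section Layering.
Variables (V : finType) (e : rel V) (L : V -> nat) (n r D1 D2 : nat).
Hypothesis se : symmetric e.
Hypothesis LL : forall k u v, dle e k u v -> L v <= L u + k.

Definition block a P := [set v | a <= L v < a + P].

(** A block consists of [2 * n + 1] strips of width [g > r]: one gap for each of the [n] colours,
    and strips separating the gaps from each other and from the block ends. A coarse step [r2] can
    go [r] to a fine piece, [D1] across it and [r] back. *)
Let g := r.+1.
Let P := (2 * n + 1) * g.
Let r2 := D1 + 2 * r.
Hypothesis fiber_fine : forall a, exists col : V -> nat, (forall v, col v < n) /\
  forall u v, u \in block a P -> connect (chain e r (block a P) col) u v -> dle e D1 u v.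
Hypothesis fiber_coarse : forall a, exists col : V -> nat, (forall v, col v < n) /\
  forall u v, u \in block a P -> connect (chain e r2 (block a P) col) u v -> dle e D2 u v.
Let b v := L v %/ P.
Let o v := L v %% P.

Lemma block_width_gt0 : 0 < P.
Proof. by rewrite /P muln_gt0 addn1. Qed.

Lemma offset_lt v : o v < P.
Proof. by rewrite ltn_mod block_width_gt0. Qed.

Lemma LE v : L v = b v * P + o v.
Proof. exact: divn_eq. Qed.

Lemma step_cases k u v : k <= r -> dle e k u v -> dle e k v u ->
  [\/ b v = b u /\ (o v <= o u + r /\ o u <= o v + r),
      b v = (b u).+1 /\ (o v < r /\ P <= o u + r) |
      b u = (b v).+1 /\ (o u < r /\ P <= o v + r)].
Proof.
move=> kr /LL uv /LL vu; rewrite !LE in uv vu.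
have ou := offset_lt u; have ov := offset_lt v.
have rP : r < P by rewrite /P /g; nia.
have sm i j x y : x < P -> y < P -> j * P + y <= i * P + x + k -> j <= i.+1.
  move=> xP yP; rewrite leqNgt => H; apply/negP => ij; move: H.
  have : (i + 2) * P <= j * P by rewrite leq_mul2r; apply/orP; right; lia.
  by rewrite mulnDl; lia.
have h1 := sm _ _ _ _ ou ov uv; have h2 := sm _ _ _ _ ov ou vu.
have [E|[E|E]] : b v = b u \/ (b v = (b u).+1 \/ b u = (b v).+1) by lia.
- by apply: Or31; rewrite E in uv vu *; split=> //; lia.
- by apply: Or32; rewrite E mulSn in uv vu *; split=> //; lia.
by apply: Or33; rewrite E mulSn in uv vu *; split=> //; lia.
Qed.

Lemma in_block v : v \in block (b v * P) P.
Proof. by rewrite inE; have := LE v; have := offset_lt v; lia. Qed.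

Let fine a := fun col : V -> nat => (forall v, col v < n) /\
  forall u v, u \in block (a * P) P -> connect (chain e r (block (a * P) P) col) u v ->
    dle e D1 u v.
Let coarse a := fun col : V -> nat => (forall v, col v < n) /\
  forall u v, u \in block (a * P) P -> connect (chain e r2 (block (a * P) P) col) u v ->
    dle e D2 u v.

Section Colour.
Variables (cf cc : nat -> V -> nat).
Hypothesis cfP : forall v, fine (b v) (cf (b v)).
Hypothesis ccP : forall v, coarse (b v) (cc (b v)).
Let ing i v := (2 * i + 1) * g <= o v < (2 * i + 2) * g.
Let col v := if odd (b v) then (if ing (cf (b v) v) v then n else cf (b v) v)
  else cc (b v) v.
Local Notation Rc := (chain e r setT col).

Lemma Rc_step u v : Rc u v -> [/\ col u = col v, dle e r u v, dle e r v u &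
  [\/ b v = b u /\ (o v <= o u + r /\ o u <= o v + r),
      b v = (b u).+1 /\ (o v < r /\ P <= o u + r) |
      b u = (b v).+1 /\ (o u < r /\ P <= o v + r)]].
Proof.
move=> /and4P[_ _ /eqP cuv uv]; have vu := dle_sym se uv.
by split=> //; apply: step_cases uv vu.
Qed.

Lemma gap_bounds i v : i < n -> ing i v -> g <= o v /\ o v + g <= P.
Proof.
move=> ni /andP[lo hi]; split; first by apply: leq_trans lo; nia.
have : (2 * i + 3) * g <= P by rewrite /P leq_mul2r; apply/orP; right; lia.
by move: hi; rewrite !mulnDl; lia.
Qed.

Lemma gap_inj i j u v : ing i u -> ing j v -> o v <= o u + r -> o u <= o v + r -> i = j.
Proof.
have key a c x y : a < c -> x < (2 * a + 2) * g -> (2 * c + 1) * g <= y -> y <= x + r -> False.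
  move=> ac; have : (2 * a + 3) * g <= (2 * c + 1) * g by rewrite leq_mul2r; apply/orP; right; lia.
  by rewrite !mulnDl /g; lia.
move=> /andP[ui iu] /andP[vj jv] uv vu.
by case: (ltngtP i j) => // ij; [case: (key i j (o u) (o v))|case: (key j i (o v) (o u))].
Qed.

(** Gaps are more than [r] apart and more than [r] from other blocks, so a chain of the extra colour
    stays in one gap of one block and is a chain of a single fine colour. *)
Lemma extra_bound u v : col u = n -> connect Rc u v -> dle e D1 u v.
Proof.
move=> cu uv.
have gapn w : col w = n -> odd (b w) /\ ing (cf (b w) w) w.
  rewrite /col; case: ifP => ow; last first.
    by have [lt _] := ccP w; have := lt w; lia.
  case: ifP => // _; have [lt _] := cfP w; have := lt w; lia.
suff [_ [_ con]] : col v = n /\ (b v = b u /\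
    connect (chain e r (block (b u * P) P) (cf (b u))) u v).
  by have [_] := cfP u; apply=> //; apply: in_block.
apply: (connect_inv (I := fun v => col v = n /\ (b v = b u /\
    connect (chain e r (block (b u * P) P) (cf (b u))) u v)) _ _ uv) => //.
move=> x y [cx [bx con]] /Rc_step[cxy xy yx cs]; have cy := cx; rewrite cxy in cy.
have [ox gx] := gapn x cx; have [oy gy] := gapn y cy.
have [cfx _] := cfP x; have [gx1 gx2] := gap_bounds (cfx x) gx.
have [byx ooyx] : b y = b x /\ (o y <= o x + r /\ o x <= o y + r).
  by case: cs => -[? [? ?]]; rewrite /g in gx1 gx2; (split; last split); ar.
split=> //; split; first by rewrite byx.
apply: connect_trans con (connect1 _).
have E : cf (b x) x = cf (b y) y by apply: gap_inj gx gy _ _; case: ooyx.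
have xb := in_block x; have yb := in_block y; rewrite byx bx in E xb yb.
by rewrite /chain /= xb yb E eqxx.
Qed.

(** The coarse block to which the piece of [v] can attach: its own block, or for a fine block the
    neighbour on the side of the gap of [col v] where [v] lies. It is an invariant of chains
    avoiding the extra colour. *)
Let ev v := if odd (b v) then (if o v < (2 * col v + 1) * g then (b v).-1 else (b v).+1)
  else b v.

Lemma nogap v : col v < n -> odd (b v) -> cf (b v) v = col v /\ ~~ ing (col v) v.
Proof.
rewrite /col => lt od; rewrite od in lt *; case: ifP lt => [|/negbT]; first by rewrite ltnn.
by [].
Qed.

(** An [r]-step cannot jump over a gap, and it crosses a block end only on the side recorded by
    [ev]. *)
Lemma ev_step u v : col u < n -> Rc u v -> ev v = ev u.
Proof.
move=> cu /Rc_step[cuv _ _ cs]; have cv := cu; rewrite cuv in cv.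
have big : (2 * col u + 2) * g + r < P.
  have : (2 * col u + 3) * g <= P by rewrite /P leq_mul2r; apply/orP; right; lia.
  by rewrite !mulnDl /g; lia.
have small : r < (2 * col u + 1) * g by rewrite mulnDl /g; nia.
rewrite /ev -cuv; case: cs => -[bE [o1 o2]]; rewrite bE.
- case: ifP => // od; have od' : odd (b v) by rewrite bE.
  have [_ nu] := nogap cu od; have [_ nv] := nogap cv od'.
  move: nu nv; rewrite /ing -cuv !negb_and -!leqNgt -!ltnNge.
  have : (2 * col u + 1) * g + g = (2 * col u + 2) * g by rewrite -mulSnr addn1 addn2.
  by rewrite /g; do 2!case: ifP; lia.
- rewrite /=; case: (odd (b u)) => /=; last by rewrite ifT //; lia.
  by rewrite ifF //; rewrite mulnDl in big; apply/negbTE; rewrite -leqNgt; rewrite mulnDl; lia.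
rewrite /=; case: (odd (b v)) => /=; last by rewrite [in RHS]ifT //; lia.
by rewrite ifF //; rewrite mulnDl in big; apply/negbTE; rewrite -leqNgt; rewrite mulnDl; lia.
Qed.


Let cchain a := chain e r2 (block (a * P) P) (cc a).
Let fchain a := chain e r (block (a * P) P) (cf a).

Lemma fine_link x y : col x < n -> odd (b x) -> odd (b y) -> Rc x y ->
  b y = b x /\ fchain (b x) x y.
Proof.
move=> cx ox oy xy; have [cxy dxy _ cs] := Rc_step xy.
have byx : b y = b x by case: cs => -[// E _]; move: ox oy; rewrite E /=; case: (odd _).
split=> //; have [Ex _] := nogap cx ox.
have [Ey _] : cf (b y) y = col y /\ ~~ ing (col y) y by apply: nogap; rewrite // -cxy.
have xb := in_block x; have yb := in_block y; rewrite byx in Ey yb.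
by rewrite /fchain /chain /= xb yb Ex Ey cxy eqxx.
Qed.

Lemma fine_dle a x y : odd a -> x \in block (a * P) P -> b x = a ->
  connect (fchain a) x y -> dle e D1 x y.
Proof. by move=> _ xa <- xy; have [_] := cfP x; apply=> //; apply: in_block. Qed.

Lemma coarse_centre w0 w : col w0 < n -> ~~ odd (b w0) -> connect Rc w0 w ->
  dle e (D2 + (r + D1)) w0 w.
Proof.
move=> c0 o0 w0w.
(* [x] is the last coarse vertex met; [w] is [x] itself or lies on the fine piece entered at [y] by
   one step from [x]. By [ev] the chain can only come back to the same coarse block. *)
pose I w := [/\ col w = col w0, ev w = b w0 & exists x, [/\ ~~ odd (b x), b x = b w0,
  col x = col w0, connect (cchain (b w0)) w0 x & (w = x \/ exists y, [/\ dle e r x y,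
    odd (b w), b y = b w & connect (fchain (b w)) y w])]].
have [_ _ [x [ox bx cx con wE]]] : I w.
  apply: (connect_inv (I := I) _ _ w0w); last first.
    split=> //; first by rewrite /ev (negPf o0).
    by exists w0; split=> //; left.
  move=> a b' [ca ea [x [ox bx cx con aE]]] ab; have [cab dab _ _] := Rc_step ab.
  have can : col a < n by rewrite ca.
  have eb : ev b' = b w0 by rewrite (ev_step can ab).
  split=> //; first by rewrite -cab.
  (* Out to the fine piece, across it and one step further: [r + D1 + r], which is [r2]. *)
  have dxb : dle e r2 x b'.
    case: aE => [<-|[y [xy oa bya con']]]; first by apply: dle_mono dab; rewrite /r2; ar.
    have ya : dle e D1 y a.
      by apply: fine_dle con' => //; rewrite -bya; apply: in_block.
    by apply: dle_mono (dle_trans (dle_trans xy ya) dab); rewrite /r2; ar.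
  have [ob|nob] := boolP (odd (b b')).
    exists x; split=> //; right; case: aE => [ax|[y [xy oa bya con']]].
      by exists b'; split=> //; rewrite -ax.
    have [bb fab] := fine_link can oa ob ab.
    exists y; rewrite bb; split=> //; exact: connect_trans con' (connect1 fab).
  have bb : b b' = b w0 by rewrite -eb /ev (negPf nob).
  exists b'; split=> //; [by rewrite -cab| |by left].
  apply: connect_trans con (connect1 _).
  have xb := in_block x; have yb := in_block b'; rewrite bx in xb; rewrite bb in yb.
  rewrite /cchain /chain /= xb yb dxb andbT; apply/eqP.
  by move: cx cab ca; rewrite /col (negPf ox) (negPf nob) bx bb => -> <- ->.
have w0x : dle e D2 w0 x by have [_] := ccP w0; apply=> //; apply: in_block.
case: wE => [->|[y [xy oa bya con']]]; first by apply: dle_mono w0x; ar.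
apply: dle_trans w0x (dle_trans xy _).
by apply: fine_dle con' => //; rewrite -bya; apply: in_block.
Qed.

(** A component has the extra colour, or contains a vertex of a coarse block from which it is
    measured, or is a single fine piece. *)
Lemma layer_bound u v : connect Rc u v -> dle e (2 * (D2 + (r + D1))) u v.
Proof.
move=> uv.
have coln w : col w <= n.
  rewrite /col; have [f1 _] := cfP w; have [f2 _] := ccP w.
  by case: ifP => _; [case: ifP => // _|]; apply: ltnW.
have := coln u; rewrite leq_eqVlt => /orP[/eqP cu|cu].
  by apply: dle_mono (extra_bound cu uv); ar.
have Rs : connect_sym Rc by apply: sym_connect_sym; apply: chain_sym.
have comp w : connect Rc u w -> col w = col u.
  by move=> uw; have [] := chain_inv (in_setT u) uw.
have [/existsP[w /andP[uw ow]]|nex] := boolP [exists w, connect Rc u w && ~~ odd (b w)].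
  have cw : col w < n by rewrite comp.
  have wu : connect Rc w u by rewrite Rs.
  have h1 := coarse_centre cw ow wu.
  have h2 := coarse_centre cw ow (connect_trans wu uv).
  by apply: dle_mono (dle_trans (dle_sym se h1) h2); ar.
have {}nex w : connect Rc u w -> odd (b w).
  move=> uw; apply/negPn/negP => ow; case/negP: nex; apply/existsP; exists w.
  by rewrite uw.
have [_ [_ con]] : connect Rc u v /\ (b v = b u /\ connect (fchain (b u)) u v).
  apply: (connect_inv (I := fun v => connect Rc u v /\ (b v = b u /\
    connect (fchain (b u)) u v)) _ _ uv) => // x y [ux [bx con]] xy.
  have uy := connect_trans ux (connect1 xy); split=> //.
  have cx : col x < n by rewrite comp.
  have [by_ fxy] := fine_link cx (nex x ux) (nex y uy) xy.
  by rewrite by_ bx; split=> //; apply: connect_trans con (connect1 _); rewrite -bx.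
apply: (@dle_mono _ _ D1); first ar.
by apply: fine_dle con; rewrite ?in_block ?nex.
Qed.

End Colour.

Theorem layering : exists col : V -> nat, (forall v, col v < n.+1) /\
  forall u v, connect (chain e r setT col) u v -> dle e (2 * (D2 + (r + D1))) u v.
Proof.
(* Finitely many blocks occur, so their colourings can be chosen together. *)
pose B := (\max_v b v).+1.
have bB v : b v < B by rewrite ltnS; apply: leq_bigmax.
have [cf cfP] : exists cf : 'I_B -> V -> nat, forall a : 'I_B, fine a (cf a).
  apply: (fin_all_exists (P := fun (a : 'I_B) c => fine a c)) => a; exact: fiber_fine.
have [cc ccP] : exists cc : 'I_B -> V -> nat, forall a : 'I_B, coarse a (cc a).
  apply: (fin_all_exists (P := fun (a : 'I_B) c => coarse a c)) => a; exact: fiber_coarse.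
pose ext (c : 'I_B -> V -> nat) (a : nat) := c (inord a).
have hf v : fine (b v) (ext cf (b v)) by have := cfP (inord (b v)); rewrite /= inordK.
have hc v : coarse (b v) (ext cc (b v)) by have := ccP (inord (b v)); rewrite /= inordK.
exists (fun v => if odd (b v) then
    (if (2 * ext cf (b v) v + 1) * g <= o v < (2 * ext cf (b v) v + 2) * g then n
     else ext cf (b v) v) else ext cc (b v) v); split; last first.
  move=> u v; exact: layer_bound.
move=> v; have [f1 _] := hf v; have [f2 _] := hc v.
by case: ifP => _; [case: ifP => // _|]; apply: ltnW; rewrite ltnS.
Qed.

End Layering.

Import Order.TTheory GRing.Theory Num.Theory.

(** * Euclidean distance and cells *)

Section Euclid.
Local Open Scope ring_scope.
Variable d : nat.
Implicit Types x y z : 'I_d -> R.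

Lemma cauchy_schwarz x y :
  (\sum_i x i * y i) ^+ 2 <= (\sum_i x i ^+ 2) * (\sum_i y i ^+ 2).
Proof.
set A := \sum_i x i ^+ 2; set B := \sum_i y i ^+ 2; set C := \sum_i _.
have B0 : 0 <= B by apply: sumr_ge0 => i _; apply: sqr_ge0.
have [BE|Bn] := eqVneq B 0.
  have y0 i : y i = 0.
    have /eqP := BE; rewrite psumr_eq0 => [/allP/(_ i)|? _]; last exact: sqr_ge0.
    by rewrite mem_index_enum sqrf_eq0 => /(_ isT)/eqP.
  have -> : C = 0 by apply: big1 => i _; rewrite y0 mulr0.
  by rewrite BE mulr0 expr0n.
have Bp : 0 < B by rewrite lt_def Bn.
have H : 0 <= \sum_i (B * x i - C * y i) ^+ 2 by apply: sumr_ge0 => i _; apply: sqr_ge0.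
have E : \sum_i (B * x i - C * y i) ^+ 2 = B * (A * B - C ^+ 2).
  transitivity (\sum_i (B ^+ 2 * x i ^+ 2 + (- 2 * B * C) * (x i * y i) + C ^+ 2 * y i ^+ 2)).
    by apply: eq_bigr => i _; ring.
  by rewrite !big_split /= -!mulr_sumr -/A -/B -/C; ring.
by move: H; rewrite E pmulr_rge0 // subr_ge0.
Qed.

Definition dE x y : R := Num.sqrt (sqdist x y).

Lemma sqdist_ge0 x y : 0 <= sqdist x y.
Proof. by apply: sumr_ge0 => i _; apply: sqr_ge0. Qed.

Lemma dE_ge0 x y : 0 <= dE x y.
Proof. exact: sqrtr_ge0. Qed.

Lemma dE_sqr x y : dE x y ^+ 2 = sqdist x y.
Proof. by rewrite sqr_sqrtr ?sqdist_ge0. Qed.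

Lemma dE_sym x y : dE x y = dE y x.
Proof. by congr Num.sqrt; apply: eq_bigr => i _; ring. Qed.

Lemma dExx x : dE x x = 0.
Proof.
by rewrite /dE [sqdist _ _](_ : _ = 0) ?sqrtr0 //; apply: big1 => i _; rewrite subrr expr0n.
Qed.

Lemma dE_triangle y x z : dE x z <= dE x y + dE y z.
Proof.
rewrite -(@ler_pXn2r _ 2) ?nnegrE ?addr_ge0 ?dE_ge0 // sqrrD !dE_sqr.
pose C := \sum_i (x i - y i) * (y i - z i).
have -> : sqdist x z = sqdist x y + C *+ 2 + sqdist y z.
  by rewrite -mulr_natl /sqdist /C mulr_sumr -!big_split /=; apply: eq_bigr => i _; ring.
rewrite lerD2r lerD2l lerMn2r /=; apply: le_trans (ler_norm _) _.
rewrite -sqrtr_sqr -sqrtrM ?sqdist_ge0 //; apply: ler_wsqrtr; exact: cauchy_schwarz.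
Qed.

Lemma dE_coord x y i : `|x i - y i| <= dE x y.
Proof.
rewrite -sqrtr_sqr; apply: ler_wsqrtr; rewrite /sqdist (bigD1 i) //= lerDl.
by apply: sumr_ge0 => j _; apply: sqr_ge0.
Qed.

(** The factor [d] is a crude replacement for the square root of [d]; only boundedness matters. *)
Lemma dE_le x y b : (forall i, `|x i - y i| <= b) -> 0 <= b -> dE x y <= d%:R * b.
Proof.
move=> xyb b0; rewrite -(@ler_pXn2r _ 2) ?nnegrE ?mulr_ge0 ?dE_ge0 // dE_sqr.
have H : sqdist x y <= d%:R * b ^+ 2.
  apply: le_trans (_ : \sum_(i < d) b ^+ 2 <= _).
    by apply: ler_sum => i _; rewrite -[leLHS]real_normK ?num_real // ler_pXn2r ?nnegrE.
  by rewrite sumr_const card_ord mulr_natl.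
apply: le_trans H _; rewrite exprMn ler_wpM2r ?sqr_ge0 // -natrX ler_nat.
by case: (d) => // m; rewrite -mulnn leq_pmulr.
Qed.

Definition interp (t : R) x y : 'I_d -> R := fun i => x i + t * (y i - x i).

Lemma dE_interp t x y : 0 <= t -> dE x (interp t x y) = t * dE x y.
Proof.
move=> t0; rewrite /dE [sqdist _ _](_ : _ = t ^+ 2 * sqdist x y).
  by rewrite sqrtrM ?sqr_ge0 // sqrtr_sqr ger0_norm.
by rewrite /sqdist mulr_sumr; apply: eq_bigr => i _; rewrite /interp; ring.
Qed.

Lemma dE_interp1 t x y : t <= 1 -> dE (interp t x y) y = (1 - t) * dE x y.
Proof.
move=> t1; rewrite /dE [sqdist _ _](_ : _ = (1 - t) ^+ 2 * sqdist x y).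
  by rewrite sqrtrM ?sqr_ge0 // sqrtr_sqr ger0_norm // subr_ge0.
by rewrite /sqdist mulr_sumr; apply: eq_bigr => i _; rewrite /interp; ring.
Qed.

End Euclid.

(* Integer cells: the line is cut into unit intervals, and colour [i] discards every
   [k]-th of them. *)
Section Cells.
Variable k : nat.

(** Adding [k] keeps the truncated subtraction exact for [i < k]. Each cell begins with its gap, so
    kept points of distinct cells differ by at least 2, a margin that survives rounding of real
    coordinates. *)
Definition cell (i n : nat) := (n + k - i) %/ k.
Definition gap (i n : nat) := (n + k - i) %% k == 0.

Lemma cell_neq i m n : i < k -> ~~ gap i m -> ~~ gap i n -> cell i m <> cell i n ->
  m + 2 <= n \/ n + 2 <= m.
Proof.
move=> ik; rewrite /gap /cell; set a := m + k - i; set b := n + k - i => ga gb ab.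
have k0 : 0 < k by lia.
have aE := divn_eq a k; have bE := divn_eq b k.
have := ltn_pmod a k0; have := ltn_pmod b k0.
move: (a %/ k) (b %/ k) (a %% k) (b %% k) ab aE bE ga gb => qa qb ra rb ab aE bE ga gb rbk rak.
have [lt|lt] : qa < qb \/ qb < qa by lia.
  have : qa.+1 * k <= qb * k by rewrite leq_mul2r lt orbT.
  by rewrite mulSn /a /b in aE bE *; lia.
have : qb.+1 * k <= qa * k by rewrite leq_mul2r lt orbT.
by rewrite mulSn /a /b in aE bE *; lia.
Qed.

Lemma cell_eq i m n : i < k -> cell i m = cell i n -> m <= n + k.
Proof.
move=> ik; rewrite /cell => E.
have k0 : 0 < k by lia.
have := divn_eq (m + k - i) k; have := divn_eq (n + k - i) k.
have := ltn_pmod (m + k - i) k0; rewrite E; lia.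
Qed.

Lemma gap_modn i n : i < k -> gap i n -> n %% k = i.
Proof.
move=> ik; rewrite /gap => /eqP g0.
have k0 : 0 < k by lia.
have := divn_eq (n + k - i) k; rewrite g0 addn0; move: (_ %/ k) => q E.
have q0 : 0 < q by case: q E => //; lia.
have -> : n = (q.-1) * k + i by case: q q0 E => // q _; rewrite mulSn /=; lia.
by rewrite modnMDl modn_small.
Qed.

End Cells.

(** Pigeonhole: each of the [d] coordinates is a gap for only one of the [d + 1] colours. *)
Lemma free_colour (d : nat) (t : 'I_d -> nat) :
  exists i, i < d.+1 /\ forall j, ~~ gap d.+1 i (t j).
Proof.
pose f j : 'I_d.+1 := inord (t j %% d.+1).
have [i /negP ni] : exists i : 'I_d.+1, i \notin codom f.
  apply/existsP; rewrite -negb_forall; apply/negP => /forallP all.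
  have : #|'I_d.+1| <= #|codom f|.
    by apply: subset_leq_card; apply/subsetP => x _; apply: all.
  rewrite card_ord leqNgt ltnS; apply/negP/negPn.
  by apply: leq_trans (leq_image_card _ _) _; rewrite card_ord.
exists i; split=> // j; apply/negP => /(gap_modn (ltn_ord i)) E; apply: ni.
by apply/codomP; exists j; apply: val_inj; rewrite /= inordK ?ltn_mod.
Qed.

(** * Ball graphs *)

Section Balls.
Local Open Scope ring_scope.
Variables (d r : nat) (V : finType) (c : V -> 'I_d -> R) (rad : V -> R) (F : {set V}).

Definition ball_rel : rel V :=
  [rel u v | [&& u \in F, v \in F & dE (c u) (c v) <= rad u + rad v]].
Local Notation h := ball_rel.

Lemma ball_rel_sym : symmetric h.
Proof. by move=> u v; rewrite /ball_rel /= andbCA dE_sym [rad u + _]addrC. Qed.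

Lemma ball_rel_in k u v : u \in F -> dle h k u v -> v \in F.
Proof.
elim: k u => [|k IH] u uF; first by rewrite dle0 => /eqP <-.
by case/dle_case=> [<- //|[w /and3P[_ wF _]]]; apply: IH.
Qed.

Hypothesis rad_gt0 : forall v, 0 < rad v.

Lemma path_dist k u v b : dle h k u v -> (forall w, dle h k u w -> rad w <= b) ->
  dE (c u) (c v) <= 2 * k%:R * b.
Proof.
elim: k u => [|k IH] u; first by rewrite dle0 => /eqP-> _; rewrite dExx !mulr0 mul0r.
move=> uv ub; have b0 : 0 <= b by apply: le_trans (ub u (dle_refl _ _ _)); apply: ltW.
case/dle_case: uv => [->|[w uw wv]].
  by rewrite dExx !mulr_ge0.
have wb : forall x, dle h k w x -> rad x <= b.
  by move=> x wx; apply: ub; apply: dle_cons wx.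
have h1 := IH w wv wb; have h2 := ub u (dle_refl _ _ _); have h3 := wb w (dle_refl _ _ _).
have h4 := dE_triangle (c w) (c u) (c v); case/and3P: uw => _ _ h5.
by rewrite -[k.+1%:R]natr1; lra.
Qed.

(* The first ball of radius at least [s] on a path. *)
Lemma first_big k u v s : 0 <= s -> dle h k u v -> s <= rad v ->
  exists y, [/\ dle h k u y, s <= rad y & dE (c u) (c y) <= rad y + 2 * k%:R * s].
Proof.
move=> s0; elim: k u => [|k IH] u.
  rewrite dle0 => /eqP-> sv; exists v; split=> //; first exact: dle_refl.
  by rewrite dExx; have := rad_gt0 v; lra.
move=> uv sv; have [su|us] := lerP s (rad u).
  exists u; split=> //; first exact: dle_refl.
  by rewrite dExx addr_ge0 ?(ltW (rad_gt0 u)) // !mulr_ge0.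
case/dle_case: uv => [E|[w uw wv]]; first by move: us; rewrite E; lra.
case/and3P: (uw) => _ _ h5; have k0 : 0 <= k%:R * s by rewrite mulr_ge0.
have [sw|ws] := lerP s (rad w).
  exists w; split=> //; first by apply: dle_cons uw (dle_refl _ _ _).
  by rewrite -[k.+1%:R]natr1; lra.
have [y [wy sy yd]] := IH w wv sv; exists y; split=> //; first exact: dle_cons wy.
have h4 := dE_triangle (c w) (c u) (c y).
by rewrite -[k.+1%:R]natr1; lra.
Qed.

(** * Chains of bounded scale inside one class of balls *)

Section Chains.
(** [f v] is a largest ball within [r] steps of [v], [a v] its scale, [cls v] the family of cells
    chosen for it and [cl v] its cell. At scale [S], a cell has diameter at most [Q * S], and cells
    of one family are more than [lam * S] apart; [E1 * S] will bound components of scale below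
    [S]. *)
Variables (T : eqType) (f : V -> V) (a cls : V -> nat) (cl : V -> T).
Variables (m0 K lam E1 Q : R).
Let rr : R := r%:R.
Let s n := m0 * K ^+ n.
Hypotheses (m0_gt0 : 0 < m0) (K_ge1 : 1 <= K) (E1_ge0 : 0 <= E1).
Hypothesis lamP : 8 * (rr * K) + E1 <= lam.
Hypothesis E1P : 8 * (rr * K) + 2 * E1 + Q <= K * E1.
Hypothesis f_dle : forall v, dle h r v (f v).
Hypothesis f_max : forall v w, dle h r v w -> rad w <= rad (f v).
Hypothesis a_lo : forall v, s (a v) <= rad (f v).
Hypothesis a_hi : forall v, rad (f v) < s (a v).+1.
Hypothesis cell_near : forall u v, cls u = cls v -> a u = a v -> cl u = cl v ->
  dE (c (f u)) (c (f v)) <= Q * s (a u).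
Hypothesis cell_far : forall u v, cls u = cls v -> a u = a v -> cl u <> cl v ->
  lam * s (a u) < dE (c (f u)) (c (f v)).

Definition link : rel V :=
  [rel u v | [&& u \in F, v \in F, cls u == cls v & dle h r u v]].

Lemma link_sym : symmetric link.
Proof.
by move=> u v; rewrite /link /= andbCA [cls u == _]eq_sym (dle_symE ball_rel_sym r u v).
Qed.

Lemma s_gt0 n : 0 < s n.
Proof. by rewrite mulr_gt0 // exprn_gt0 //; apply: lt_le_trans K_ge1. Qed.

Lemma sS n : s n.+1 = K * s n.
Proof. by rewrite /s exprS; ring. Qed.

Lemma rr_ge0 : 0 <= rr. Proof. exact: ler0n. Qed.

Lemma K_ge0 : 0 <= K. Proof. exact: le_trans K_ge1. Qed.

Lemma a_hi_le v : rad (f v) <= K * s (a v).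
Proof. by rewrite -sS ltW. Qed.

Lemma short_dist u v : dle h r u v -> dE (c u) (c v) <= 2 * (rr * K * s (a u)).
Proof.
move=> uv; have := path_dist uv (f_max (v := u)).
have := ler_wpM2l rr_ge0 (a_hi_le u); rewrite -/rr; nra.
Qed.

Lemma link_dist u v : link u v -> dE (c u) (c v) <= 2 * (rr * K * s (a u)) /\
  dE (c u) (c v) <= 2 * (rr * K * s (a v)).
Proof.
move=> uv; have /and4P[_ _ _ vu] : link v u by rewrite link_sym.
by case/and4P: uv => _ _ _ uv; rewrite {2}dE_sym; split; apply: short_dist.
Qed.

Definition low n : rel V := [rel x y | [&& link x y, (a x < n)%N & (a y < n)%N]].

Lemma low_sym n : connect_sym (low n).
Proof.
by apply: sym_connect_sym => x y; rewrite /low /= link_sym [X in _ && X]andbC.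
Qed.

Lemma low_inv n u v : (a u < n)%N -> connect (low n) u v ->
  (a v < n)%N /\ cls v = cls u.
Proof.
move=> un; apply: (@connect_inv _ _ (fun v => (a v < n)%N /\ cls v = cls u)) => //.
by move=> x y [_ <-] /and3P[/and4P[_ _ /eqP -> _] _ yn].
Qed.

(* By induction on the scale: the members of top scale all lie in the same cell. *)
Lemma low_dist n u v : (a u < n)%N -> connect (low n) u v ->
  dE (c u) (c v) <= E1 * s n.
Proof.
elim: n u v => [|n IH] u v // un uv; rewrite sS.
have S0 := s_gt0 n; set S := s n in S0 *.
have {}IH x y : (a x < n)%N -> connect (low n) x y -> dE (c x) (c y) <= E1 * S.
  exact: IH.
set W := rr * K * S.
have rK0 : 0 <= rr * K by apply: mulr_ge0; [exact: rr_ge0|exact: K_ge0].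
have W0 : 0 <= W by apply: mulr_ge0 => //; apply: ltW.
have ES0 : 0 <= E1 * S by apply: mulr_ge0 => //; apply: ltW.
have i1 : 8 * W + E1 * S <= lam * S.
  have := ler_wpM2r (ltW S0) lamP; rewrite /W; lra.
have i2 : 8 * W + 2 * (E1 * S) + Q * S <= E1 * (K * S).
  have := ler_wpM2r (ltW S0) E1P; rewrite /W; lra.
have ld x y : link x y -> (a x <= n)%N -> dE (c x) (c y) <= 2 * W.
  move=> /link_dist[h1 _] xn; apply: le_trans h1 _; rewrite ler_pM2l // /W.
  apply: ler_wpM2l => //.
  by rewrite /S /s ler_pM2l // ler_weXn2l.
(* The walk is followed from one top-scale member to the next; in between it may run through a
   component of smaller scale, entered at [v1]. *)
have top_close u0 w : a u0 = n -> connect (low n.+1) u0 w -> exists w1,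
    [/\ a w1 = n, cls w1 = cls u0, cl w1 = cl u0 & (w = w1 \/
      (exists v1, [/\ link w1 v1, (a v1 < n)%N & connect (low n) v1 w]))].
  move=> u0n; apply: (@connect_inv _ _ (fun w => exists w1,
    [/\ a w1 = n, cls w1 = cls u0, cl w1 = cl u0 & (w = w1 \/
      (exists v1, [/\ link w1 v1, (a v1 < n)%N & connect (low n) v1 w]))])); last first.
    by exists u0; split=> //; left.
  move=> x y [w1 [w1n cw1 lw1 xE]] /and3P[xy xn yn].
  have [yn'|ny] := ltnP (a y) n.
    exists w1; split=> //; right; case: xE => [<-|[v1 [wv v1n con]]]; first by exists y.
    exists v1; split=> //; have [xn' _] := low_inv v1n con.
    by apply: connect_trans con (connect1 _); rewrite /low /= xy yn' xn'.
  have {ny} ay : a y = n by apply/eqP; rewrite eqn_leq ny -ltnS yn.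
  have cy : cls y = cls u0.
    have /and4P[_ _ /eqP <- _] := xy; case: xE => [xw|[v1 [wv v1n con]]].
      by rewrite xw.
    by have [_ ->] := low_inv v1n con; have /and4P[_ _ /eqP <- _] := wv.
  (* Two links and one smaller component. Passing to the largest nearby balls adds [4 * W], and the
     total stays within [lam * S], so the cell cannot change. *)
  have dwy : dE (c w1) (c y) <= 4 * W + E1 * S.
    have dxy := ld x y xy xn.
    case: xE => [xw|[v1 [wv v1n con]]]; first by rewrite -xw; lra.
    have h1 := ld _ _ wv; rewrite w1n leqnn in h1; have := h1 isT.
    have := IH _ _ v1n con.
    by have := dE_triangle (c v1) (c w1) (c y); have := dE_triangle (c x) (c v1) (c y); lra.
  exists y; split=> //; last by left.
  apply/eqP/negPn/negP => /eqP nc; have := @cell_far w1 y; rewrite cw1 cy w1n ay lw1.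
  have := short_dist (f_dle w1); have := short_dist (f_dle y); rewrite w1n ay -/S -/W.
  have := dE_triangle (c w1) (c (f w1)) (c (f y)).
  have := dE_triangle (c y) (c w1) (c (f y)); rewrite (dE_sym (c (f w1)) (c w1)).
  move=> t1 t2 t3 t4 /(_ erefl erefl (fun E => nc (esym E))); lra.
have top_dist u0 w : a u0 = n -> connect (low n.+1) u0 w -> exists w1,
    [/\ a w1 = n, cls w1 = cls u0, cl w1 = cl u0 & dE (c w1) (c w) <= 2 * W + E1 * S].
  move=> u0n /(top_close _ _ u0n)[w1 [w1n cw1 lw1 wE]]; exists w1; split=> //.
  case: wE => [->|[v1 [wv v1n con]]]; first by rewrite dExx; lra.
  have h1 := ld _ _ wv; rewrite w1n leqnn in h1; have := h1 isT.
  by have := IH _ _ v1n con; have := dE_triangle (c v1) (c w1) (c w); lra.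
have [/existsP[w0 /andP[uw0 /eqP w0n]]|nex] :=
  boolP [exists w, connect (low n.+1) u w && (a w == n)].
  have w0u : connect (low n.+1) w0 u by rewrite low_sym.
  have [u1 [u1n cu1 lu1 du]] := top_dist _ _ w0n w0u.
  have [v1 [v1n cv1 lv1 dv]] := top_dist _ _ w0n (connect_trans w0u uv).
  have := @cell_near u1 v1; rewrite cu1 cv1 u1n v1n lu1 lv1 => /(_ erefl erefl erefl).
  have := short_dist (f_dle u1); have := short_dist (f_dle v1); rewrite u1n v1n -/S -/W.
  have := dE_triangle (c u1) (c u) (c v); have := dE_triangle (c v1) (c u1) (c v).
  have := dE_triangle (c (f u1)) (c u1) (c v1).
  have := dE_triangle (c (f v1)) (c (f u1)) (c v1).
  rewrite (dE_sym (c u) (c u1)) (dE_sym (c (f v1)) (c v1)); lra.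
have {}nex w : connect (low n.+1) u w -> (a w < n)%N.
  move=> uw; have [] := low_inv un uw; rewrite ltnS leq_eqVlt => /orP[wn|//].
  by case/negP: nex; apply/existsP; exists w; rewrite uw.
have [_ con] : connect (low n.+1) u v /\ connect (low n) u v.
  apply: (connect_inv (I := fun v => connect (low n.+1) u v /\ connect (low n) u v)
    _ _ uv) => // x y [ux con] xy; have uy := connect_trans ux (connect1 xy).
  split=> //; apply: connect_trans con (connect1 _).
  by case/and3P: xy => xy _ _; rewrite /low /= xy !nex.
apply: le_trans (IH u v (nex u (connect0 _ _)) con) _.
by apply: ler_wpM2l => //; apply: ler_peMl K_ge1; apply: ltW.
Qed.


Variable rho : V -> nat.
Hypothesis rho_rad : forall u v, (rho u <= rho v)%N -> rad (f u) <= rad (f v).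
(** In units of [s (a t)]: the diameter of [below t], one link out of it, and the walk to the first
    large ball. *)
Let M0 := E1 * K + 2 * (rr * K) + 2 * rr.

Lemma M0_ge0 : 0 <= M0.
Proof.
have rK0 : 0 <= rr * K by apply: mulr_ge0; [exact: rr_ge0|exact: K_ge0].
have EK0 : 0 <= E1 * K by apply: mulr_ge0 => //; exact: K_ge0.
have := rr_ge0; rewrite /M0; lra.
Qed.

Lemma a_mono u v : rad (f u) <= rad (f v) -> (a u <= a v)%N.
Proof.
move=> uv; rewrite leqNgt; apply/negP => vu.
have h1 := a_lo u; have h2 : rad (f v) < s (a v).+1 by apply: a_hi.
have : s (a v).+1 <= s (a u) by rewrite ler_pM2l // ler_weXn2l.
lra.
Qed.

Lemma bag_single t z : t \notin F -> z \in bag link rho t -> z = t.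
Proof.
move=> tF; rewrite in_setU1 => /orP[/eqP//|/sepP[_ [u]]].
rewrite inE => tu /and4P[uF _ _ _].
have [ut|tF'] : u = t \/ t \in F.
  apply: (connect_inv (I := fun u => u = t \/ t \in F) _ _ tu); last by left.
  by move=> x y [->|?] /and3P[/and4P[? _ _ _] _ _]; right.
  by rewrite -ut uF in tF.
by rewrite tF' in tF.
Qed.

(** A boundary vertex has larger rank, so some ball of radius at least [s (a t)] lies within [r]
    steps of it. The first such ball on the way is reached through smaller balls only, hence stays
    close to [t]. *)
Lemma bag_big_ball t z : t \in F -> z \in bag link rho t -> exists y,
  [/\ y \in F, dle h r z y, s (a t) <= rad y &
      dE (c t) (c y) <= rad y + M0 * s (a t)].
Proof.
move=> tF; have S0 := s_gt0 (a t); set S := s (a t) in S0 *.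
have rK0 : 0 <= rr * K by apply: mulr_ge0; [exact: rr_ge0|exact: K_ge0].
have rKS0 : 0 <= rr * K * S by apply: mulr_ge0 => //; apply: ltW.
have EKS0 : 0 <= E1 * (K * S).
  by apply: mulr_ge0 => //; apply: mulr_ge0; [exact: K_ge0|exact: ltW].
have rS0 : 0 <= rr * S by apply: mulr_ge0; [exact: rr_ge0|exact: ltW].
rewrite in_setU1 => /orP[/eqP->|/sepP[tz [u ut uz]]].
  exists (f t); split; [exact: ball_rel_in (f_dle t)|exact: f_dle|exact: a_lo|].
  have := short_dist (f_dle t); have := rad_gt0 (f t); rewrite -/S /M0; lra.
have /and4P[uF zF _ uz'] := uz.
have Sz : S <= rad (f z) by apply: le_trans (a_lo t) (rho_rad (ltnW tz)).
have [y [zy Sy yd]] := first_big (ltW S0) (f_dle z) Sz.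
exists y; split=> //; first exact: ball_rel_in zy.
have au : (a u <= a t)%N by apply: a_mono; apply: rho_rad; apply: below_rank ut.
have tu : dE (c t) (c u) <= E1 * (K * S).
  rewrite -sS; apply: low_dist => //; move: ut; rewrite inE; apply: connect_sub.
  move=> x y' /and3P[xy xt yt]; apply: connect1; rewrite /low /= xy !ltnS.
  by rewrite !a_mono // rho_rad.
have duz : dE (c u) (c z) <= 2 * (rr * K * S).
  have [h1 _] := link_dist uz; apply: le_trans h1 _; rewrite ler_pM2l //.
  by apply: ler_wpM2l => //; rewrite /S /s ler_pM2l // ler_weXn2l.
have := dE_triangle (c u) (c t) (c y); have := dE_triangle (c z) (c u) (c y).
by rewrite -/rr in yd; rewrite /M0; lra.
Qed.

(* Shrinking the balls to a common radius turns disjointness into separation of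
   centres in a bounded region, so a grid yields the clusters. *)
Lemma bag_clusters G t : (0 < d)%N -> 2 * (M0 + 1) * d%:R < G%:R ->
  exists L : seq {set V}, [/\ (size L <= #|{ffun 'I_d -> 'I_G.+1}|)%N,
    forall Q', Q' \in L -> forall u v, u \in Q' -> v \in Q' -> dle h (2 * r + 1) u v &
    forall y, y \in bag link rho t -> exists2 Q', Q' \in L & y \in Q'].
Proof.
move=> d_gt0 GP; have [tF|tF] := boolP (t \in F); last first.
  exists [:: [set t]]; split.
  - by apply/card_gt0P; exists [ffun => ord0].
  - by move=> Q'; rewrite inE => /eqP-> u v /set1P-> /set1P->; apply: dle_refl.
  by move=> y /(bag_single tF) ->; exists [set t]; rewrite inE.
have S0 := s_gt0 (a t); set S := s (a t) in S0.
have [y yP] : exists y : V -> V, forall z, z \in bag link rho t ->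
    [/\ y z \in F, dle h r z (y z), S <= rad (y z) &
      dE (c t) (c (y z)) <= rad (y z) + M0 * S].
  apply: (fin_all_exists (P := fun z y => z \in bag link rho t ->
    [/\ y \in F, dle h r z y, S <= rad y & dE (c t) (c y) <= rad y + M0 * S])) => z.
  have [zb|] := boolP (z \in bag link rho t); last by exists z.
  by have [y] := bag_big_ball tF zb; exists y.
have M0S : 0 <= M0 * S by apply: mulr_ge0; [exact: M0_ge0|exact: ltW].
(* The centre of [y z] is moved towards [c t] by at most [rad (y z) - S], so the ball of radius [S]
   about [p z] lies inside the ball [y z]. *)
pose th z := (rad (y z) - S) / (rad (y z) + M0 * S).
pose p z := interp (th z) (c (y z)) (c t).
have pP z : z \in bag link rho t ->
    dE (c (y z)) (p z) <= rad (y z) - S /\ dE (p z) (c t) <= (M0 + 1) * S.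
  move=> /yP[yF _ yS yd]; have den : 0 < rad (y z) + M0 * S.
    by have := rad_gt0 (y z); lra.
  have th0 : 0 <= th z by rewrite divr_ge0 ?subr_ge0 // ltW.
  have th1 : th z <= 1 by rewrite ler_pdivrMr // mul1r; lra.
  have thE : th z * (rad (y z) + M0 * S) = rad (y z) - S by rewrite divfK // gt_eqF.
  rewrite dE_interp // dE_interp1 // dE_sym; split.
    by rewrite -thE; apply: ler_wpM2l.
  have th1' : 0 <= 1 - th z by rewrite subr_ge0.
  by apply: le_trans (ler_wpM2l th1' yd) _; rewrite mulrBl thE; lra.
(* Coordinates in units of [S / d]: points of one grid cell are within [S], so the balls [y u] and
   [y v] meet. *)
pose x z j := (p z j - c t j + (M0 + 1) * S) * d%:R / S.
have dp : 0 < d%:R :> R by rewrite ltr0n.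
have xP z j : z \in bag link rho t -> 0 <= x z j < G%:R.
  move=> /pP[_ h1]; have := le_trans (dE_coord (p z) (c t) j) h1.
  rewrite ler_norml => /andP[h2 h3]; apply/andP; split.
    by apply: divr_ge0; [apply: mulr_ge0; [lra|exact: ltW]|exact: ltW].
  rewrite ltr_pdivrMr //; apply: le_lt_trans (_ : 2 * (M0 + 1) * d%:R * S < _).
    by rewrite mulrAC ler_pM2r //; lra.
  by rewrite ltr_pM2r.
have tr z j : z \in bag link rho t -> (Num.truncn (x z j) < G.+1)%N.
  move=> zb; have /andP[h1 h2] := xP z j zb; rewrite ltnS -(ler_nat R).
  by apply: le_trans (ltW h2); have /andP[] := truncn_itv h1.
pose gr z : {ffun 'I_d -> 'I_G.+1} := [ffun j => inord (Num.truncn (x z j))].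
have memQ z g : (z \in [set w in bag link rho t | gr w == g]) =
    (z \in bag link rho t) && (gr z == g) by rewrite [LHS]in_set.
exists [seq [set z in bag link rho t | gr z == g] | g <- enum {ffun 'I_d -> 'I_G.+1}].
split; first by rewrite size_map -cardE.
  move=> Q' /mapP[g _ ->] u v; rewrite !memQ => /andP[ub /eqP ug] /andP[vb /eqP vg].
  have [yuF uy yuS _] := yP u ub; have [yvF vy yvS _] := yP v vb.
  have [pu _] := pP u ub; have [pv _] := pP v vb.
  suff yuv : h (y u) (y v).
    have -> : (2 * r + 1 = r + 1 + r)%N by ar.
    apply: dle_trans (dle_sym ball_rel_sym vy); exact: dle_trans uy (dle_edge yuv).
  rewrite /ball_rel /= yuF yvF /=.
  have puv : dE (p u) (p v) <= S.
    have -> : S = d%:R * (S / d%:R) by rewrite mulrC divfK // gt_eqF.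
    apply: dE_le; last by rewrite divr_ge0 ?ltW.
    move=> j; have E : Num.truncn (x u j) = Num.truncn (x v j).
      by move/ffunP/(_ j): ug; rewrite -vg !ffunE => /(congr1 val); rewrite /= !inordK ?tr.
    have /andP[/truncn_itv/andP[u1 u2] _] := xP u j ub.
    have /andP[/truncn_itv/andP[v1 v2] _] := xP v j vb.
    rewrite E in u1 u2; rewrite -natr1 in u2 v2.
    have : `|x u j - x v j| <= 1 by rewrite ler_norml; lra.
    have -> : x u j - x v j = (p u j - p v j) * (d%:R / S) by rewrite /x; ring.
    rewrite normrM [`|_ / _|]ger0_norm; last by apply: divr_ge0; apply: ltW.
    by rewrite -ler_pdivlMr ?divr_gt0 // div1r invf_div.
  have := dE_triangle (p u) (c (y u)) (c (y v)); have := dE_triangle (p v) (p u) (c (y v)).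
  by rewrite (dE_sym (p v) (c (y v))); lra.
move=> z zb; exists [set w in bag link rho t | gr w == gr z].
  by apply/mapP; exists (gr z); rewrite ?mem_enum.
by rewrite memQ zb eqxx.
Qed.

End Chains.
End Balls.

(** * Scales, cells and ranks for a given ball graph *)

Section Instance.
Local Open Scope ring_scope.

Lemma finite_lower_bound (V : finType) (g : V -> R) : (forall v, 0 < g v) ->
  exists m0, 0 < m0 /\ forall v, m0 <= g v.
Proof.
move=> g0; case: (pickP (fun _ : V => true)) => [v0 _|no]; last first.
  by exists 1; split=> // v; have := no v.
case: (arg_minP (P := xpredT) g (i0 := v0) isT) => v _ vm.
by exists (g v); split=> // w; apply: vm.
Qed.

Lemma finite_coord_bound (d : nat) (V : finType) (c : V -> 'I_d -> R) :
  exists B, forall v j, 0 <= c v j + B.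
Proof.
exists (\sum_v \sum_j `|c v j|) => v j; rewrite -lerBlDl sub0r.
apply: le_trans (_ : `|c v j| <= _); first by rewrite -normrN ler_norm.
rewrite (bigD1 v) //= (bigD1 j) //= -addrA lerDl.
by apply: addr_ge0; repeat (apply: sumr_ge0 => ? _ //).
Qed.

Lemma scale_ex (m0 K x : R) : 0 < m0 -> 2 <= K -> m0 <= x ->
  exists n, m0 * K ^+ n <= x /\ x < m0 * K ^+ n.+1.
Proof.
move=> m00 K2 mx.
(* Since [K >= 2], [K ^+ n] is at least [n]. *)
have ex : exists n, x < m0 * K ^+ n.
  exists (Num.truncn (x / m0)).+1; rewrite mulrC -ltr_pdivrMr //.
  have x0 : 0 <= x / m0 by rewrite divr_ge0 //; [apply: le_trans mx; apply: ltW|apply: ltW].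
  have /andP[_ lt] := truncn_itv x0; apply: lt_le_trans lt _.
  move: (_.+1) => n; elim: n => [|n IH]; first by rewrite expr0.
  rewrite exprS -natr1; case: n IH => [|n] IH; first by rewrite expr0; lra.
  have : 1 <= n.+1%:R :> R by rewrite ler1n.
  have K0 : 0 <= K by lra.
  by have := ler_wpM2l K0 IH; nra.
case: (ex_minnP ex) => n xn nmin; case: n xn nmin => [|n] xn nmin.
  by move: xn; rewrite expr0 mulr1; lra.
exists n; split=> //; rewrite leNgt; apply/negP => /nmin; rewrite ltnn //.
Qed.

(** Ties are broken by the position in a sorted list, which makes the rank injective. *)
Lemma rank_by (V : finType) (g : V -> R) : exists rho : V -> nat,
  injective rho /\ forall u v, (rho u <= rho v)%N -> g u <= g v.
Proof.
pose s := sort (relpre g <=%R) (enum V).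
have ms v : v \in s by rewrite mem_sort mem_enum.
exists (fun v => index v s); split=> [u v|u v].
  by move=> /(congr1 (nth u s)); rewrite !nth_index.
apply: (sorted_leq_index (leT := relpre g <=%R)) => //.
- by move=> a b c; apply: le_trans.
- by move=> a; apply: lexx.
by apply: sort_sorted => a b; apply: le_total.
Qed.

Lemma truncn_close (x y : R) k : 0 <= x -> 0 <= y ->
  (Num.truncn x <= Num.truncn y + k)%N -> x < y + k%:R + 1.
Proof.
move=> /truncn_itv/andP[_ x2] /truncn_itv/andP[y1 _]; rewrite -(ler_nat R) natrD => xy.
by rewrite -natr1 in x2; lra.
Qed.

Lemma truncn_far (x y : R) : 0 <= x -> 0 <= y ->
  (Num.truncn x + 2 <= Num.truncn y)%N -> x + 1 < y.
Proof.
move=> /truncn_itv/andP[_ x2] /truncn_itv/andP[y1 _]; rewrite -(ler_nat R) natrD => xy.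
by rewrite -natr1 in x2; lra.
Qed.

(** The colour of a ball records one of [d + 1] families of cells and one bit from the elimination
    order inside that family. *)
Theorem ball_graph_colouring (d r : nat) : (0 < d)%N -> exists D, forall (V : finType)
    (c : V -> 'I_d -> R) (rad : V -> R) (F : {set V}), (forall v, 0 < rad v) ->
  exists col : V -> nat, (forall v, (col v < 2 * d.+1)%N) /\
    forall u v, u \in F -> connect (chain (ball_rel c rad F) r F col) u v ->
      dle (ball_rel c rad F) D u v.
Proof.
(* With [lam = 2 * E1], condition [E1P] asks for [8 * (rr * K) + Q <= (K - 2) / 2 * lam]. This [K]
   gives [Q = (K - 3) / 2 * lam], which leaves [lam / 2] for the first term, equal to
   [(lam - 1) / 2]. *)
move=> d0; pose rr : R := r%:R; pose K : R := (3 + 2 * d * (d + 2))%:R.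
pose lam := 16 * (rr * K) + 1; pose E1 := 8 * (rr * K) + 1 / 2.
pose k := d.+1; pose Q := d%:R * (k%:R + 1) * lam.
have rr0 : 0 <= rr by exact: ler0n.
have K3 : 3 <= K by rewrite ler_nat leq_addr.
have rK0 : 0 <= rr * K by apply: mulr_ge0 => //; lra.
have lamP : 8 * (rr * K) + E1 <= lam by rewrite /lam /E1; lra.
have lam0 : 0 < lam by rewrite /lam; lra.
have E10 : 0 <= E1 by rewrite /E1; lra.
have lE : E1 = lam / 2 by rewrite /lam /E1; lra.
have E1P : 8 * (rr * K) + 2 * E1 + Q <= K * E1.
  have -> : Q = (K - 3) / 2 * lam.
    by rewrite /Q /K /k -[d.+1%:R]natr1 !natrD !natrM !natrD; field.
  by rewrite lE /lam; lra.
pose M0 := E1 * K + 2 * (rr * K) + 2 * rr.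
pose G := (Num.truncn (2 * (M0 + 1) * d%:R)).+1.
have GP : 2 * (M0 + 1) * d%:R < G%:R by apply: truncnS_gt.
have [D DP] := elimination_colouring_clusters #|{ffun 'I_d -> 'I_G.+1}|.
exists (D * (2 * r + 1))%N => V c rad F rad0.
pose h := ball_rel c rad F.
have sh : symmetric h := ball_rel_sym c rad F.
have [m0 [m00 m0r]] := finite_lower_bound rad0.
have [B BP] := finite_coord_bound c.
have [f fP] : exists f : V -> V, forall v, dle h r v (f v) /\
    forall w, dle h r v w -> rad w <= rad (f v).
  apply: (fin_all_exists (P := fun v y => dle h r v y /\
    forall w, dle h r v w -> rad w <= rad y)) => v.
  case: (arg_maxP (P := fun w => dle h r v w) rad (i0 := v) (dle_refl _ _ _)) => y vy my.
  by exists y; split=> // w; apply: my.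
have [a aP] : exists a : V -> nat, forall v, m0 * K ^+ a v <= rad (f v) /\
    rad (f v) < m0 * K ^+ (a v).+1.
  apply: (fin_all_exists (P := fun v n => m0 * K ^+ n <= rad (f v) /\
    rad (f v) < m0 * K ^+ n.+1)) => v.
  by apply: scale_ex => //; lra.
pose s n := m0 * K ^+ n.
have s0 n : 0 < s n by rewrite mulr_gt0 // exprn_gt0 //; lra.
(* Coordinates in units of [lam] times the scale of [v], shifted by [B] to be nonnegative before
   rounding. *)
pose x v j := (c (f v) j + B) / (lam * s (a v)).
have ls0 v : 0 < lam * s (a v) by rewrite mulr_gt0.
have x0 v j : 0 <= x v j by apply: divr_ge0 => //; apply: ltW.
have [cls clsP] : exists cls : V -> nat, forall v, (cls v < k)%N /\
    forall j, ~~ gap k (cls v) (Num.truncn (x v j)).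
  apply: (fin_all_exists (P := fun v i => (i < k)%N /\
    forall j, ~~ gap k i (Num.truncn (x v j)))) => v.
  exact: free_colour.
pose cl v : {ffun 'I_d -> nat} := [ffun j => cell k (cls v) (Num.truncn (x v j))].
have xE u v j : a u = a v -> c (f u) j - c (f v) j = (x u j - x v j) * (lam * s (a u)).
  move=> auv; have := ls0 u; rewrite /x -auv => /lt0r_neq0 l0.
  by rewrite -mulrBl divfK //; ring.
have near_ u v : cls u = cls v -> a u = a v -> cl u = cl v ->
    dE (c (f u)) (c (f v)) <= Q * s (a u).
  move=> cuv auv /ffunP luv.
  have -> : Q * s (a u) = d%:R * ((k%:R + 1) * (lam * s (a u))) by rewrite /Q; ring.
  apply: dE_le => [j|]; last by apply: mulr_ge0; [apply: addr_ge0|exact: ltW].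
  have := luv j; rewrite !ffunE cuv => E.
  have ik := (clsP v).1.
  have h1 := truncn_close (x0 u j) (x0 v j) (cell_eq ik E).
  have h2 := truncn_close (x0 v j) (x0 u j) (cell_eq ik (esym E)).
  rewrite xE // normrM [`|lam * _|]gtr0_norm //; apply: ler_wpM2r; first exact: ltW.
  by rewrite ler_norml; lra.
have far_ u v : cls u = cls v -> a u = a v -> cl u <> cl v ->
    lam * s (a u) < dE (c (f u)) (c (f v)).
  move=> cuv auv /eqP nl.
  have [j lj] : exists j, cl u j != cl v j.
    apply/existsP; rewrite -negb_forall; apply: contra nl => /forallP al.
    by apply/eqP/ffunP => j; apply/eqP.
  apply: lt_le_trans (dE_coord _ _ j); rewrite xE // normrM [`|lam * _|]gtr0_norm //.
  rewrite -[ltLHS]mul1r ltr_pM2r //; move: lj; rewrite !ffunE cuv => /eqP lj.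
  have [ik gv] := clsP v; have [_ gu] := clsP u; rewrite cuv in gu.
  have [lt|lt] := cell_neq ik (gu j) (gv j) lj.
    by have := truncn_far (x0 u j) (x0 v j) lt; rewrite ltr_normr; lra.
  by have := truncn_far (x0 v j) (x0 u j) lt; rewrite ltr_normr; lra.
have [rho [rhoI rhoP]] := rank_by (rad \o f).
pose e := link r c rad F cls.
pose q : rel V := dle h (2 * r + 1).
have K1 : 1 <= K by lra.
have [|||t|b bP] := DP V e q rho.
- exact: link_sym.
- by move=> u v; apply: dle_symE.
- exact: rhoI.
- have flo v := (aP v).1; have fhi v := (aP v).2.
  have fd v := (fP v).1; have fm v := (fP v).2.
  exact: (bag_clusters rad0 m00 K1 E10 lamP E1P fd fm flo fhi near_ far_ rhoP t d0 GP).
exists (fun v => 2 * cls v + b v)%N; split=> [v|u v uF uv].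
  by have [ik _] := clsP v; rewrite /k in ik; case: (b v); ar.
apply: (dle_scale (e := relU e q)) => [y z|].
  case/orP=> [/and4P[_ _ _ yz]|//]; apply: dle_mono yz; ar.
apply: bP; apply: connect_sub uv => y z /and4P[yF zF /eqP cyz yz]; apply: connect1.
have [E1' E2'] : cls y = cls z /\ b y = b z.
  by move: cyz; case: (b y); case: (b z) => cyz; split=> //; move: cyz; ar.
by rewrite /e /link /= yF zF E1' E2' yz !eqxx.
Qed.

End Instance.

(** * Reduction of sphere graphs to ball graphs *)

(* For [d >= 2] this says that the spheres of centres [c u], [c v] and radii [rad u],
   [rad v] meet; for [d = 1] it says that two intervals overlap without strict nesting. *)
Definition touching (d : nat) (V : finType) (c : V -> 'I_d -> R) (rad : V -> R) : rel V :=
  [rel u v | (`|rad u - rad v| <= dE (c u) (c v))%R &&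
             (dE (c u) (c v) <= rad u + rad v)%R].

Section Spheres.
Local Open Scope ring_scope.
Variables (d : nat) (V : finType) (e : rel V) (c : V -> 'I_d -> R) (rad : V -> R).
Hypotheses (se : symmetric e) (rad_gt0 : forall v, 0 < rad v).
Hypothesis eE : forall u v, u != v -> e u v = touching c rad u v.

Definition nested u v := dE (c u) (c v) < rad v - rad u.

Lemma edge_touching u v : e u v -> u = v \/
  `|rad u - rad v| <= dE (c u) (c v) /\ dE (c u) (c v) <= rad u + rad v.
Proof.
have [->|uv] := eqVneq u v; [by left|].
by rewrite eE // => /andP[]; right.
Qed.

Lemma overlap_cases u v : dE (c u) (c v) <= rad u + rad v ->
  [\/ u = v, e u v, nested u v | nested v u].
Proof.
move=> ov; have [->|uv] := eqVneq u v; first by apply: Or41.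
have [euv|] := boolP (e u v); first by apply: Or42.
rewrite eE // /touching /= ov andbT -ltNge /nested (dE_sym (c v)).
have [h1|h1] := lerP (rad u) (rad v).
  by move=> h2; apply: Or43.
by move=> h2; apply: Or44.
Qed.

(** A sphere [y] touching [x] overlaps the ball [v] and cannot strictly contain it, since then [x]
    would lie strictly inside [y]. *)
Lemma nested_step x y v : nested x v -> e x y -> [\/ y = v, e y v | nested y v].
Proof.
move=> xv exy; case: (edge_touching exy) => [<-|[h1 h2]]; first by apply: Or33.
have t1 := dE_triangle (c x) (c y) (c v); rewrite (dE_sym (c y) (c x)) in t1.
have yv : dE (c y) (c v) <= rad y + rad v by move: xv; rewrite /nested; lra.
case: (overlap_cases yv) => [||yv'|vy]; [by apply: Or31|by apply: Or32|by apply: Or33|].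
have t2 := dE_triangle (c v) (c x) (c y).
by move: xv vy h1; rewrite /nested ler_norml => ? ? /andP[]; lra.
Qed.

Lemma nested_exit k x w v : dle e k x w -> nested x v -> ~~ nested w v ->
  exists p i j, [/\ dle e 1 p v, dle e i x p, dle e j p w & (i + j <= k)%N].
Proof.
move=> xw xv wv.
have [w1 [w2 [i [j [n1 n2 e12 xw1 [w2w ij]]]]]] :=
  dle_exit (P := fun u => nested u v) xw xv wv.
exists w2, i.+1, j; split=> //; last by rewrite addSnnS.
  case: (nested_step n1 e12) => [->|w2v|n3]; [exact: dle_refl|exact: dle_edge|].
  by rewrite n3 in n2.
by rewrite -addn1; apply: dle_trans xw1 (dle_edge e12).
Qed.

Variables (o : V -> V) (L : V -> nat).
Hypothesis o_comp : forall u v, connect e u v -> o u = o v.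
Hypothesis o_max : forall v, rad v <= rad (o v).
Hypothesis L_dle : forall v, dle e (L v) (o v) v.
Hypothesis L_min : forall k v, dle e k (o v) v -> (L v <= k)%N.

Lemma L_step k u v : dle e k u v -> (L v <= L u + k)%N.
Proof.
move=> uv; apply: L_min; rewrite -(o_comp (dle_connect uv)).
exact: dle_trans (L_dle u) uv.
Qed.

(* The largest sphere of the component is not inside [v], so a geodesic from [u] to it
   has to cross [v]. *)
Lemma nested_dle u v : nested u v -> connect e u v -> dle e (L u + 2 - L v) u v.
Proof.
move=> uv con; have nov : ~~ nested (o u) v.
  rewrite (o_comp con) /nested -leNgt; have := o_max v; have := dE_ge0 (c (o v)) (c v); lra.
have [p [i [j [pv up po ij]]]] := nested_exit (dle_sym se (L_dle u)) uv nov.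
have ov : o p = o u by rewrite (o_comp (dle_connect up)).
have Lp : (L p <= j)%N by apply: L_min; rewrite ov dle_symE.
have Lv := L_step pv.
by apply: dle_mono (dle_trans up pv); lia.
Qed.

Lemma overlap_dle u v a P : dE (c u) (c v) <= rad u + rad v -> connect e u v ->
  (a <= L u < a + P)%N -> (a <= L v < a + P)%N -> dle e (P + 2) u v.
Proof.
move=> ov con La Lb; case: (overlap_cases ov) => [->|uv|uv|vu].
- exact: dle_refl.
- by apply: dle_mono (dle_edge uv); lia.
- by apply: dle_mono (nested_dle uv con); lia.
rewrite dle_symE //; apply: dle_mono (nested_dle vu _); first lia.
by rewrite sym_connect_sym.
Qed.

(** In each component the block is fattened by [k] levels on both sides and coloured as a ball
    graph. Walks of length [k] from the block stay in the fattened block and are walks of balls;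
    conversely, balls meeting there are within [P + 2 * k + 2] in [e]. *)
Lemma sphere_fiber k P D : (forall (F : {set V}), exists col : V -> nat,
    (forall v, (col v < 2 * d.+1)%N) /\ forall u v, u \in F ->
    connect (chain (ball_rel c rad F) k F col) u v -> dle (ball_rel c rad F) D u v) ->
  forall a, exists col : V -> nat, (forall v, (col v < 2 * d.+1)%N) /\
    forall u v, u \in block L a P -> connect (chain e k (block L a P) col) u v ->
      dle e (D * (P + 2 * k + 2)) u v.
Proof.
(* If [a < k] the subtraction truncates to 0, and the [P + 2 * k] levels from there still contain
   the fattened block. *)
move=> ball a; pose F y := [set v | (o v == y) && (a - k <= L v < a - k + (P + 2 * k))%N].
have [col colP] : exists col : V -> V -> nat, forall y, (forall v, (col y v < 2 * d.+1)%N) /\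
    forall u v, u \in F y -> connect (chain (ball_rel c rad (F y)) k (F y) (col y)) u v ->
      dle (ball_rel c rad (F y)) D u v.
  apply: (fin_all_exists (P := fun y (cl : V -> nat) =>
    (forall v, (cl v < 2 * d.+1)%N) /\ forall u v, u \in F y ->
    connect (chain (ball_rel c rad (F y)) k (F y) cl) u v ->
    dle (ball_rel c rad (F y)) D u v)) => y; exact: ball.
exists (fun v => col (o v) v); split=> [v|u v ub uv]; first by have [] := colP (o v).
have blkF x w : x \in block L a P -> dle e k x w -> w \in F (o x).
  rewrite !inE => xb xw; have := L_step xw; have := L_step (dle_sym se xw).
  by rewrite -(o_comp (dle_connect xw)) eqxx; lia.
have [_ [_ con]] : v \in block L a P /\ (o v = o u /\
    connect (chain (ball_rel c rad (F (o u))) k (F (o u)) (col (o u))) u v).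
  apply: (connect_inv (I := fun v => v \in block L a P /\ (o v = o u /\
    connect (chain (ball_rel c rad (F (o u))) k (F (o u)) (col (o u))) u v)) _ _ uv) => //.
  move=> x y [xb [ox con]] /and4P[_ yb /eqP cxy xy].
  have oy : o y = o u by rewrite -ox (o_comp (dle_connect xy)).
  split=> //; split=> //; apply: connect_trans con (connect1 _).
  have xF := blkF x x xb (dle_refl _ _ _); have yF := blkF y y yb (dle_refl _ _ _).
  rewrite ox in xF cxy; rewrite oy in yF cxy.
  rewrite /chain /= xF yF cxy eqxx /=.
  have inF w : dle e k x w -> w \in F (o u) by rewrite -ox; apply: blkF.
  apply: dle_sub (dle_avoid inF xy) => p q /and3P[pq pF qF].
  rewrite /ball_rel /= pF qF /=; case: (edge_touching pq) => [->|[]//].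
  by rewrite dExx addr_ge0 // ltW.
have uF := blkF u u ub (dle_refl _ _ _).
have [_ colD] := colP (o u).
apply: dle_scale (colD u v uF con) => p q /and3P[pF qF pq].
move: pF qF; rewrite !inE => /andP[/eqP op Lp] /andP[/eqP oq Lq].
apply: overlap_dle pq _ Lp Lq.
have := dle_connect (L_dle q); rewrite oq -op => h1.
apply: connect_trans h1; rewrite sym_connect_sym //; exact: dle_connect (L_dle p).
Qed.

End Spheres.

Theorem touching_graph_colouring (d r : nat) : 0 < d -> exists D, forall (V : finType)
    (e : rel V) (c : V -> 'I_d -> R) (rad : V -> R), symmetric e ->
    (forall v, (0 < rad v)%R) -> (forall u v, u != v -> e u v = touching c rad u v) ->
  exists col : V -> nat, (forall v, col v < 2 * d + 3) /\
    forall u v, connect (chain e r setT col) u v -> dle e D u v.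
Proof.
(* The block width depends on [r] and [n] only; the coarse scale [r2] depends on the fine bound
   [D1], so [B1] is fixed before [B2]. *)
move=> d0; pose n := 2 * d.+1; pose P := (2 * n + 1) * r.+1.
have [B1 B1P] := ball_graph_colouring r d0; pose D1 := B1 * (P + 2 * r + 2).
pose r2 := D1 + 2 * r.
have [B2 B2P] := ball_graph_colouring r2 d0; pose D2 := B2 * (P + 2 * r2 + 2).
exists (2 * (D2 + (r + D1))) => V e c rad se rad0 eE.
have [o0 o0P] : exists o0 : V -> V, forall x, connect e x (o0 x) /\
    forall w, connect e x w -> (rad w <= rad (o0 x))%R.
  apply: (fin_all_exists (P := fun x y => connect e x y /\
    forall w, connect e x w -> (rad w <= rad y)%R)) => x.
  case: (arg_maxP (P := fun w => connect e x w) rad (i0 := x) (connect0 _ _)) => y xy my.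
  by exists y; split=> // w; apply: my.
have cs : connect_sym e by apply: sym_connect_sym.
pose o v := o0 (fingraph.root e v).
have o_comp u v : connect e u v -> o u = o v by move/(fingraph.rootP cs); rewrite /o => ->.
have o_con v : connect e (o v) v.
  rewrite cs; apply: connect_trans (connect_root e v) _; by have [] := o0P (fingraph.root e v).
have o_max v : (rad v <= rad (o v))%R.
  by have [_] := o0P (fingraph.root e v); apply; rewrite cs connect_root.
have [L LP] : exists L : V -> nat, forall v, dle e (L v) (o v) v /\
    forall k, dle e k (o v) v -> L v <= k.
  apply: (fin_choice_exists (P := fun v l => dle e l (o v) v /\
    forall k, dle e k (o v) v -> l <= k)) => v.
  have ex : exists k, dle e k (o v) v.
    by have /connectP[p ep lp] := o_con v; exists (size p); have := path_dle ep; rewrite -lp.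
  by case: (ex_minnP ex) => l lv lm; exists l.
have L1 v := (LP v).1; have L2 k v := (LP v).2 k.
have f1 := sphere_fiber se rad0 eE o_comp o_max L1 L2 P (fun F => B1P V c rad F rad0).
have f2 := sphere_fiber se rad0 eE o_comp o_max L1 L2 P (fun F => B2P V c rad F rad0).
have [col [col1 col2]] := layering se (L_step o_comp L1 L2) f1 f2.
by exists col; split=> // v; have := col1 v; lia.
Qed.

(** * Spheres, chords and the theorem *)

Section SphereGraphs.
Local Open Scope ring_scope.
Variable d : nat.

Lemma dE_eq0 (x y : 'I_d -> R) i : dE x y = 0 -> x i = y i.
Proof.
by move=> E; have := dE_coord x y i; rewrite E normr_le0 subr_eq0 => /eqP.
Qed.

Lemma on_sphereE (c x : 'I_d -> R) r : 0 < r -> on_sphere c r x <-> dE x c = r.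
Proof.
move=> r0; rewrite /on_sphere; split=> [E|<-]; last by rewrite dE_sqr.
by rewrite /dE E sqrtr_sqr gtr0_norm.
Qed.

Lemma orthogonal_vector (v : 'I_d -> R) i : (1 < d)%N -> v i != 0 ->
  exists w, \sum_k w k * v k = 0 /\ 0 < \sum_k w k ^+ 2.
Proof.
move=> d2 vi; have [j ji] : exists j : 'I_d, j != i.
  case: i vi => [[|m] lm] _; [exists (Ordinal d2)|exists (Ordinal (ltnW d2))] => //.
exists (fun k => if k == i then - v j else if k == j then v i else 0).
have two (g : 'I_d -> R) : (forall k, k != i -> k != j -> g k = 0) ->
    \sum_k g k = g i + g j.
  move=> g0; rewrite (bigD1 i) //= (bigD1 j) //= big1 ?addr0 // => k /andP[ki kj].
  exact: g0.
rewrite !two => [|k /negPf-> /negPf->|k /negPf-> /negPf->];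
  rewrite ?mul0r ?expr0n // eqxx (negPf ji) eqxx.
split; first by ring.
by rewrite ltr_wpDl ?sqr_ge0 // exprn_even_gt0.
Qed.

(** For the converse, a common point is built in the plane spanned by [v], the difference of the
    centres, and a vector [w] orthogonal to it. Concentric spheres have equal radii and are treated
    apart. *)
Lemma spheres_meetE (c1 c2 : 'I_d -> R) r1 r2 : (1 < d)%N -> 0 < r1 -> 0 < r2 ->
  spheres_meet c1 r1 c2 r2 <->
  (`|r1 - r2| <= dE c1 c2) && (dE c1 c2 <= r1 + r2).
Proof.
move=> d2 p1 p2; split=> [[x []]|/andP[]].
  rewrite !on_sphereE // => h1 h2.
  have := dE_triangle x c1 c2; have := dE_triangle c1 x c2; have := dE_triangle c2 x c1.
  rewrite (dE_sym c1 x) (dE_sym c2 c1) h1 h2 ler_norml => t1 t2 t3.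
  by apply/andP; split; [apply/andP; split|]; lra.
rewrite ler_norml => /andP[l1 l2] l3.
have [D0|Dn0] := eqVneq (dE c1 c2) 0.
  have r12 : r1 = r2 by rewrite D0 in l1 l2; lra.
  pose i0 : 'I_d := Ordinal (ltnW d2).
  have H : sqdist (fun i => c1 i + (if i == i0 then r1 else 0)) c1 = r1 ^+ 2.
    rewrite /sqdist (bigD1 i0) //= big1 => [|k /negPf->]; last by rewrite addr0 subrr expr0n.
    by rewrite ?eqxx addr0 [c1 i0 + _]addrC addrK.
  exists (fun i => c1 i + (if i == i0 then r1 else 0)); split=> //.
  by rewrite /on_sphere -r12 -H; apply: eq_bigr => i _; rewrite (dE_eq0 i D0).
set D := dE c1 c2 in Dn0 l1 l2 l3; have Dp : 0 < D by rewrite lt_def Dn0 dE_ge0.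
pose v i := c2 i - c1 i.
have vD : \sum_k v k ^+ 2 = D ^+ 2 by rewrite /D dE_sym dE_sqr.
have [i vi] : exists i, v i != 0.
  apply/existsP; rewrite -negb_forall; apply/negP => /forallP v0.
  move: vD; rewrite big1 => [/esym/eqP|k _]; first by rewrite sqrf_eq0 (negPf Dn0).
  by rewrite (eqP (v0 k)) expr0n.
have [w [wv w0]] := orthogonal_vector d2 vi.
set W := \sum_k w k ^+ 2 in w0.
(* [al] locates the radical hyperplane on the line of centres. *)
pose al := (D ^+ 2 + r1 ^+ 2 - r2 ^+ 2) / (2 * D ^+ 2).
have alE : al * D ^+ 2 = (D ^+ 2 + r1 ^+ 2 - r2 ^+ 2) / 2.
  by rewrite /al; field; rewrite Dn0.
have gam0 : 0 <= (r1 ^+ 2 - al ^+ 2 * D ^+ 2) / W.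
  apply: divr_ge0; last exact: ltW.
  (* A factorisation as in Heron's formula: the factors are nonnegative by the triangle inequalities
     between [D], [r1] and [r2]. *)
  have -> : r1 ^+ 2 - al ^+ 2 * D ^+ 2 =
    (r2 ^+ 2 - (D - r1) ^+ 2) * ((D + r1) ^+ 2 - r2 ^+ 2) / (2 * D) ^+ 2.
    by rewrite /al; field; rewrite Dn0.
  apply: divr_ge0; last exact: sqr_ge0.
  by apply: mulr_ge0; rewrite subr_sqr; apply: mulr_ge0; lra.
pose ga := Num.sqrt ((r1 ^+ 2 - al ^+ 2 * D ^+ 2) / W).
have gaE : ga ^+ 2 * W = r1 ^+ 2 - al ^+ 2 * D ^+ 2.
  by rewrite sqr_sqrtr // divfK // gt_eqF.
have sum_sq b : \sum_k (b * v k + ga * w k) ^+ 2 = b ^+ 2 * D ^+ 2 + ga ^+ 2 * W.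
  transitivity (\sum_k (b ^+ 2 * v k ^+ 2 + (2 * b * ga) * (w k * v k) + ga ^+ 2 * w k ^+ 2)).
    by apply: eq_bigr => k _; ring.
  by rewrite !big_split /= -!mulr_sumr vD wv -/W; ring.
exists (fun k => c1 k + al * v k + ga * w k); split; rewrite /on_sphere /sqdist.
  transitivity (\sum_k (al * v k + ga * w k) ^+ 2); first by apply: eq_bigr => k _; ring.
  by rewrite sum_sq gaE; ring.
transitivity (\sum_k ((al - 1) * v k + ga * w k) ^+ 2).
  by apply: eq_bigr => k _; rewrite /v; ring.
by rewrite sum_sq gaE; have := alE; lra.
Qed.

Lemma sphere_touching (V : finType) (e : rel V) : (1 < d)%N -> sphere_graph d e ->
  exists (c : V -> 'I_d -> R) (rad : V -> R), (forall v, 0 < rad v) /\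
    forall u v, u != v -> e u v = touching c rad u v.
Proof.
move=> d2 [c [rad [rad0 eP]]]; exists c, rad; split=> // u v uv.
have M := spheres_meetE (c u) (c v) d2 (rad0 u) (rad0 v).
by apply/idP/idP => [/(eP u v uv)/M //|h]; apply/(eP u v uv)/M.
Qed.

End SphereGraphs.

(** * Circle graphs as overlap graphs of intervals *)

Section CircleGraphs.
Local Open Scope ring_scope.
Implicit Types o p q x : R * R.

Definition orient p q x : R :=
  (q.1 - p.1) * (x.2 - p.2) - (q.2 - p.2) * (x.1 - p.1).

(** The product tells whether [p'] and [q'] lie strictly on the same side of the line [p q]. If not,
    the chord [p' q'] meets this line in a point of the disc, and the line meets the disc only in
    the chord [p q]. *)
Lemma chords_meetE (p q p' q' : R * R) : on_circle p -> on_circle q -> p <> q ->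
  on_circle p' -> on_circle q' ->
  (exists x, on_chord p q x /\ on_chord p' q' x) <-> orient p q p' * orient p q q' <= 0.
Proof.
move=> cp cq pq cp' cq'; split=> [[x [[t [t0 [t1 ->]]] [t' [t0' [t1' /= E]]]]]|H].
  case: E => E1 E2.
  have : (1 - t') * orient p q p' + t' * orient p q q' = 0.
    transitivity (orient p q ((1 - t') * p'.1 + t' * q'.1, (1 - t') * p'.2 + t' * q'.2)).
      by rewrite /orient /=; ring.
    by rewrite -E1 -E2 /orient /=; ring.
  move: (orient p q p') (orient p q q') => a b E.
  have [ab|//] := ltrP 0 (a * b).
  have h1 : 0 <= (1 - t') * (a * b) by apply: mulr_ge0; lra.
  have : (1 - t') * (a * b) + t' * b ^+ 2 = 0.
    by rewrite -[RHS](mul0r b) -E; ring.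
  have h2 : 0 <= t' * b ^+ 2 by apply: mulr_ge0 => //; apply: sqr_ge0.
  have b2 : 0 < b ^+ 2.
    by rewrite exprn_even_gt0 //=; apply: contraTN ab => /eqP->; rewrite mulr0 ltxx.
  move=> h3; have h4 : (1 - t') * (a * b) = 0 by lra.
  have h5 : t' * b ^+ 2 = 0 by lra.
  move/eqP: h5; rewrite mulf_eq0 (gt_eqF b2) orbF => /eqP t'0.
  by move: h4; rewrite t'0; lra.
have [t [t0 [t1 tE]]] : exists t, 0 <= t /\ (t <= 1 /\
    (1 - t) * orient p q p' + t * orient p q q' = 0).
  move: H; move: (orient p q p') (orient p q q') => a b H.
  have [->|a0] := eqVneq a 0; first by exists 0; split=> //; split=> //; ring.
  have ab : a - b != 0.
    have a2 : 0 < a ^+ 2 by rewrite exprn_even_gt0.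
    apply/eqP => E; have ba : b = a by lra.
    by move: H; rewrite ba -expr2; lra.
  have sq : 0 < (a - b) ^+ 2 by rewrite exprn_even_gt0.
  have a2 : 0 <= a ^+ 2 := sqr_ge0 a.
  have b2 : 0 <= b ^+ 2 := sqr_ge0 b.
  have tE : a / (a - b) = (a * (a - b)) / (a - b) ^+ 2 by field.
  exists (a / (a - b)); split; first by rewrite tE; apply: divr_ge0; [lra|exact: ltW].
  split; last by field.
  by rewrite tE ler_pdivrMr // mul1r; lra.
pose x : R * R := ((1 - t) * p'.1 + t * q'.1, (1 - t) * p'.2 + t * q'.2).
have ox : orient p q x = 0 by rewrite -tE /orient /x /=; ring.
have x1 : x.1 ^+ 2 + x.2 ^+ 2 <= 1.
  have -> : x.1 ^+ 2 + x.2 ^+ 2 = (1 - t) * (p'.1 ^+ 2 + p'.2 ^+ 2) +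
      t * (q'.1 ^+ 2 + q'.2 ^+ 2) -
      t * (1 - t) * ((p'.1 - q'.1) ^+ 2 + (p'.2 - q'.2) ^+ 2) by rewrite /x /=; ring.
  rewrite cp' cq'; have : 0 <= t * (1 - t) * ((p'.1 - q'.1) ^+ 2 + (p'.2 - q'.2) ^+ 2).
    by apply: mulr_ge0; [apply: mulr_ge0; lra|apply: addr_ge0; apply: sqr_ge0].
  lra.
pose S := (q.1 - p.1) ^+ 2 + (q.2 - p.2) ^+ 2.
have S0 : 0 < S.
  rewrite lt_def addr_ge0 ?sqr_ge0 // andbT; apply/eqP => S0; apply: pq.
  have /andP[] : ((q.1 - p.1) ^+ 2 == 0) && ((q.2 - p.2) ^+ 2 == 0).
    by rewrite -paddr_eq0 ?sqr_ge0 //; apply/eqP.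
  rewrite !sqrf_eq0 !subr_eq0 => /eqP e1 /eqP e2.
  by rewrite [p]surjective_pairing [q]surjective_pairing e1 e2.
(* The parameter of [x] on the line; [u * (1 - u) * S] is 1 minus the squared norm of [x], so [u]
   lies between 0 and 1. *)
pose u := ((x.1 - p.1) * (q.1 - p.1) + (x.2 - p.2) * (q.2 - p.2)) / S.
have u1 : x.1 = p.1 + u * (q.1 - p.1).
  have : (x.1 - p.1 - u * (q.1 - p.1)) * S = - (q.2 - p.2) * orient p q x.
    by rewrite mulrBl mulrAC /u divfK ?gt_eqF // /S /orient; ring.
  by rewrite ox mulr0 => /eqP; rewrite mulf_eq0 (gt_eqF S0) orbF => /eqP; lra.
have u2 : x.2 = p.2 + u * (q.2 - p.2).
  have : (x.2 - p.2 - u * (q.2 - p.2)) * S = (q.1 - p.1) * orient p q x.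
    by rewrite mulrBl mulrAC /u divfK ?gt_eqF // /S /orient; ring.
  by rewrite ox mulr0 => /eqP; rewrite mulf_eq0 (gt_eqF S0) orbF => /eqP; lra.
have uu : 0 <= u * (1 - u).
  have : x.1 ^+ 2 + x.2 ^+ 2 = (1 - u) * (p.1 ^+ 2 + p.2 ^+ 2) +
      u * (q.1 ^+ 2 + q.2 ^+ 2) - u * (1 - u) * S by rewrite u1 u2 /S; ring.
  rewrite cp cq => xE; have : 0 <= u * (1 - u) * S by lra.
  by rewrite pmulr_lge0.
exists x; split; last by exists t.
have u0 : 0 <= u.
  by rewrite leNgt; apply/negP => un; move: uu; rewrite nmulr_rge0 //; lra.
exists u; split=> //; split; last by rewrite [x]surjective_pairing u1 u2; congr pair; ring.
by rewrite leNgt; apply/negP => un; move: uu; rewrite pmulr_rge0; lra.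
Qed.

(* Inverse stereographic projection from [o]. *)
Definition stereo o (s : R) : R * R :=
  (o.1 * ((s ^+ 2 - 1) / (s ^+ 2 + 1)) - o.2 * (2 * s / (s ^+ 2 + 1)),
   o.2 * ((s ^+ 2 - 1) / (s ^+ 2 + 1)) + o.1 * (2 * s / (s ^+ 2 + 1))).

Lemma sqr_add1_neq0 (s : R) : s ^+ 2 + 1 != 0.
Proof. by rewrite gt_eqF // ltr_wpDl // sqr_ge0. Qed.

Lemma stereo_ex o p : on_circle o -> on_circle p -> p <> o -> exists s, p = stereo o s.
Proof.
case: o p => [a b] [x y]; rewrite /on_circle /= => ab xy po.
(* Cosine and sine of the angle from [o] to the point; [W / (1 - U)] is the cotangent of half that
   angle. *)
pose U := a * x + b * y; pose W := a * y - b * x.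
have U1 : 1 - U != 0.
  apply/eqP => E; apply: po.
  have : (x - a) ^+ 2 + (y - b) ^+ 2 = 0.
    transitivity (a ^+ 2 + b ^+ 2 + (x ^+ 2 + y ^+ 2) - 2 * U); first by rewrite /U; ring.
    by rewrite ab xy; lra.
  move/eqP; rewrite paddr_eq0 ?sqr_ge0 // !sqrf_eq0 !subr_eq0 => /andP[/eqP-> /eqP->] //.
have UW : W ^+ 2 = 1 - U ^+ 2.
  have : U ^+ 2 + W ^+ 2 = (a ^+ 2 + b ^+ 2) * (x ^+ 2 + y ^+ 2) by rewrite /U /W; ring.
  by rewrite ab xy; lra.
exists (W / (1 - U)).
have N : (W / (1 - U)) ^+ 2 + 1 = 2 / (1 - U).
  by rewrite expr_div_n UW; field.
have e1 : ((W / (1 - U)) ^+ 2 - 1) / ((W / (1 - U)) ^+ 2 + 1) = U.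
  have -> : (W / (1 - U)) ^+ 2 - 1 = 2 / (1 - U) - 2 by rewrite -N; ring.
  by rewrite N; field.
have e2 : 2 * (W / (1 - U)) / ((W / (1 - U)) ^+ 2 + 1) = W by rewrite N; field.
rewrite /stereo e1 e2 /U /W /=; congr pair.
  by transitivity (x * (a ^+ 2 + b ^+ 2)); [rewrite ab mulr1|ring].
by transitivity (y * (a ^+ 2 + b ^+ 2)); [rewrite ab mulr1|ring].
Qed.

(** Up to a positive factor the orientation of three points of the circle is the Vandermonde product
    of their coordinates, so the sign test for chords moves to the line. *)
Lemma orient_stereo o (p q x : R) : on_circle o ->
  exists2 K : R, 0 < K & orient (stereo o p) (stereo o q) (stereo o x) =
    K * ((p - q) * (x - p) * (x - q)).
Proof.
case: o => [a b]; rewrite /on_circle /= => ab.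
exists (4 / ((p ^+ 2 + 1) * (q ^+ 2 + 1) * (x ^+ 2 + 1))).
  by rewrite divr_gt0 // !mulr_gt0 // ltr_wpDl // sqr_ge0.
rewrite -[RHS]mul1r -{1}ab /orient /stereo /=; field.
by rewrite !sqr_add1_neq0.
Qed.

Lemma fresh_circle_point (s : seq (R * R)) : exists o, on_circle o /\ o \notin s.
Proof.
(* Infinitely many points of the circle: the stereographic images of the naturals. *)
pose f (n : nat) : R * R := ((n%:R ^+ 2 - 1) / (n%:R ^+ 2 + 1), 2 * n%:R / (n%:R ^+ 2 + 1)).
have fc n : on_circle (f n) by rewrite /on_circle /f /=; field; apply: sqr_add1_neq0.
have fi : injective f.
  move=> m n [E _]; have n0 := sqr_add1_neq0 (n%:R); have m0 := sqr_add1_neq0 (m%:R).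
  have : m%:R ^+ 2 = n%:R ^+ 2 :> R.
    by move/eqP: E; rewrite eqr_div // => /eqP; lra.
  by move/eqP; rewrite eqrXn2 // ?ler0n // eqr_nat => /eqP.
have [/allP al|] := boolP (all (fun n => f n \in s) (iota 0 (size s).+1)).
  have : (size (map f (iota 0 (size s).+1)) <= size s)%N.
    apply: uniq_leq_size; first by rewrite map_inj_uniq // iota_uniq.
    by move=> y /mapP[n nI ->]; apply: al.
  by rewrite size_map size_iota ltnn.
by case/allPn => n _ nf; exists (f n).
Qed.

(** With half-lengths [r], [r'] and difference of midpoints [dl], the product factors so that it is
    nonpositive exactly when [dl ^+ 2] lies between [(r - r') ^+ 2] and [(r + r') ^+ 2]. *)
Lemma interlacing (p q p' q' : R) : p != q -> p' != q' ->
  ((p' - p) * (p' - q) * ((q' - p) * (q' - q)) <= 0) =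
  (`| `|p - q| / 2 - `|p' - q'| / 2| <= `|(p + q) / 2 - (p' + q') / 2|) &&
  (`|(p + q) / 2 - (p' + q') / 2| <= `|p - q| / 2 + `|p' - q'| / 2).
Proof.
move=> pq pq'; set r := `|p - q| / 2; set r' := `|p' - q'| / 2.
set dl := (p + q) / 2 - (p' + q') / 2.
have r0 : 0 < r by rewrite divr_gt0 // normr_gt0 subr_eq0.
have r0' : 0 < r' by rewrite divr_gt0 // normr_gt0 subr_eq0.
have rE : r ^+ 2 = ((p - q) / 2) ^+ 2 by rewrite /r expr_div_n real_normK ?num_real // -expr_div_n.
have rE' : r' ^+ 2 = ((p' - q') / 2) ^+ 2 by rewrite /r' expr_div_n real_normK ?num_real // -expr_div_n.
have -> : (p' - p) * (p' - q) * ((q' - p) * (q' - q)) =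
    (dl ^+ 2 - (r + r') ^+ 2) * (dl ^+ 2 - (r - r') ^+ 2).
  transitivity ((dl ^+ 2 - (r ^+ 2 + r' ^+ 2)) ^+ 2 - 4 * r ^+ 2 * r' ^+ 2); last by ring.
  by rewrite rE rE' /dl; field.
have lt : (r - r') ^+ 2 < (r + r') ^+ 2.
  by have := mulr_gt0 r0 r0'; lra.
have -> : (`|r - r'| <= `|dl|) = ((r - r') ^+ 2 <= dl ^+ 2).
  by rewrite -[(r - r') ^+ 2]real_normK ?num_real // -[dl ^+ 2]real_normK ?num_real // ler_pXn2r ?nnegrE.
have -> : (`|dl| <= r + r') = (dl ^+ 2 <= (r + r') ^+ 2).
  by rewrite -[dl ^+ 2]real_normK ?num_real // ler_pXn2r ?nnegrE // addr_ge0 ?ltW.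
move: (dl ^+ 2) ((r - r') ^+ 2) ((r + r') ^+ 2) lt => D A B lt.
apply/idP/andP => [H|[h1 h2]]; last by apply: mulr_le0_ge0; lra.
have [BD|DB] := ltrP B D.
  by move: H; rewrite pmulr_rle0 ?subr_gt0 //; lra.
split=> //; rewrite leNgt; apply/negP => DA; move: H.
by rewrite nmulr_rle0 ?subr_lt0 //; lra.
Qed.

Lemma circle_touching (V : finType) (e : rel V) : circle_graph e ->
  exists (c : V -> 'I_1 -> R) (rad : V -> R), (forall v, 0 < rad v) /\
    forall u v, u != v -> e u v = touching c rad u v.
Proof.
case=> P [Q [PQ eP]].
have [o [co no]] := fresh_circle_point ([seq P v | v : V] ++ [seq Q v | v : V]).
have Po v : P v <> o.
  by move=> E; move: no; rewrite mem_cat -E (map_f P) ?mem_enum.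
have Qo v : Q v <> o.
  by move=> E; move: no; rewrite mem_cat -E (map_f Q) ?mem_enum ?orbT.
have [p pP] : exists p : V -> R, forall v, P v = stereo o (p v).
  apply: (fin_choice_exists (P := fun v s => P v = stereo o s)) => v.
  by have [cv _] := PQ v; apply: stereo_ex.
have [q qP] : exists q : V -> R, forall v, Q v = stereo o (q v).
  apply: (fin_choice_exists (P := fun v s => Q v = stereo o s)) => v.
  by have [_ [cv _]] := PQ v; apply: stereo_ex.
have pq v : p v != q v.
  by apply/eqP => E; have [_ [_ []]] := PQ v; rewrite pP qP E.
exists (fun v _ => (p v + q v) / 2), (fun v => `|p v - q v| / 2); split=> [v|u v uv].
  by rewrite divr_gt0 // normr_gt0 subr_eq0.
rewrite /touching /= /dE /sqdist big_ord1 sqrtr_sqr -interlacing //.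
have [cPu [cQu nPQ]] := PQ u; have [cPv [cQv _]] := PQ v.
have -> : e u v = (orient (P u) (Q u) (P v) * orient (P u) (Q u) (Q v) <= 0).
  have M := chords_meetE cPu cQu nPQ cPv cQv.
  by apply/idP/idP => [/(eP u v uv)/M //|h]; apply/(eP u v uv)/M.
rewrite !pP !qP.
have [K K0 ->] := orient_stereo (p u) (q u) (p v) co.
have [K' K0' ->] := orient_stereo (p u) (q u) (q v) co.
set X := (RHS); rewrite (_ : _ * _ = (K * K' * (p u - q u) ^+ 2) *
  ((p v - p u) * (p v - q u) * ((q v - p u) * (q v - q u)))); last by ring.
rewrite pmulr_rle0 // mulr_gt0 //; first exact: mulr_gt0.
by rewrite exprn_even_gt0 //= subr_eq0.
Qed.

End CircleGraphs.

(** * From colourings with bounded components to asymptotic dimension *)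

Lemma sphere_dim_colouring (d r : nat) : exists D, forall (V : finType) (e : rel V),
  sphere_dim_le d e -> exists col : V -> nat, (forall v, col v < 2 * d + 3) /\
    forall u v, connect (chain e r setT col) u v -> dle e D u v.
Proof.
elim: d => [|d [D DP]].
  by exists 0 => V e [_ [d' [d1 [d2 _]]]]; lia.
have [D' DP'] := touching_graph_colouring r (ltn0Sn d).
(* Smaller dimensions are covered by the induction, dimension [d.+1] by the new bound; the sum
   serves both. *)
exists (D + D') => V e [[se ie] [d' [d1 [d2 Sd]]]].
have [lt|ge] := ltnP d' d.+1.
  have [|col [c1 c2]] := DP V e; first by split=> //; exists d'.
  exists col; split=> [v|u v /c2]; first by have := c1 v; lia.
  by apply: dle_mono; lia.
have Ed : d' = d.+1 by lia.
have [c [rad [rad0 eE]]] : exists (c : V -> 'I_d.+1 -> R) (rad : V -> R),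
    (forall v, (0 < rad v)%R) /\ forall u v, u != v -> e u v = touching c rad u v.
  move: Sd; rewrite Ed /in_S; case: eqP => [[->]|nd]; first exact: circle_touching.
  by apply: sphere_touching; lia.
have [col [c1 c2]] := DP' V e c rad se rad0 eE.
exists col; split=> // u v /c2; apply: dle_mono; lia.
Qed.

Lemma dist_leE (V : finType) (e : rel V) (u v : V) (x : R) : (0 <= x)%R ->
  dist_le e u v x <-> dle e (Num.truncn x) u v.
Proof.
move=> x0; split=> [[p [up [<- px]]]|/dle_path[p [up lp sp]]].
  by apply: dle_mono (path_dle up); rewrite truncn_ge_nat.
by exists p; split=> //; split=> //; rewrite -truncn_ge_nat.
Qed.

Theorem theorem1p2 (d : nat) : (1 <= d)%N ->
  asdim_le (fun V e => @sphere_dim_le d V e) (2 * d + 2).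
Proof.
move=> _; have [D DP] := boolp.choice (sphere_dim_colouring d).
exists (2 * d + 2); split=> //; exists (fun r => (D (Num.truncn r))%:R)%R.
split=> [r _|V e Se r r0]; first exact: ler0n.
have se : symmetric e by case: Se => -[].
have [col [c1 c2]] := DP (Num.truncn r) V e Se.
(* The [i]-th family consists of the components of colour [i] under steps of length at most [r].
   Graph distances are integers, so [r] may be rounded down. *)
pose Rc := chain e (Num.truncn r) setT col.
have cs : connect_sym Rc by apply: sym_connect_sym; apply: chain_sym.
exists (fun i : 'I_(2 * d + 2).+1 =>
  [set [set w | connect Rc v w] | v in [set v | col v == i :> nat]]); split.
  move=> v; have lt : col v < (2 * d + 2).+1 by have := c1 v; lia.
  exists (Ordinal lt), [set w | connect Rc v w]; split; last by rewrite inE.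
  by apply/imsetP; exists v; rewrite ?inE.
have col_const u w : connect Rc u w -> col w = col u.
  by case/(chain_inv (in_setT u)).
split=> [i U U' /imsetP[x xi ->] /imsetP[y yi ->] nU u v|i U /imsetP[x _ ->] u v].
  rewrite !inE in xi yi *; move=> xu yv /(dist_leE _ _ _ (ltW r0)) uv.
  case/eqP: nU; apply/setP => w; rewrite !inE.
  have Ruv : Rc u v.
    by rewrite /Rc /chain /= !inE (col_const _ _ xu) (col_const _ _ yv) (eqP xi) (eqP yi) eqxx.
  rewrite cs in yv; apply: (same_connect cs).
  exact: connect_trans xu (connect_trans (connect1 Ruv) yv).
rewrite !inE => xu xv; apply/dist_leE; first exact: ler0n.
rewrite natrK; apply: c2; rewrite cs in xu; exact: connect_trans xu xv.
Qed.
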